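(* Let $n\ge3$, $\alpha\in(0,1)$, $a>0$ and $0<r_I<r_E$ satisfy $$\frac{r_I}{r_E}=\frac{1}{\cos(\frac{\pi}{n})}\left(\cos\Bigl(\frac{\pi}{n}(1-2\alpha)\Bigr)-\sqrt{\sin\Bigl(\frac{2\pi}{n}\alpha\Bigr)\sin\Bigl(\frac{2\pi}{n}(1-\alpha)\Bigr)}\right),\qquad a=\sqrt{\frac{\sin(\frac{2\pi}{n}(1-\alpha))}{\sin(\frac{2\pi}{n}\alpha)}} .$$ Let $$U(a)=a\,e_{11}\otimes e_{11}+\frac1a\,e_{11}^\perp\otimes e_{11}^\perp+\frac{a^{-1}-a}{\tan\phi}\,e_{11}\otimes e_{11}^\perp,\qquad \phi=\frac{(n-2)\pi}{2n}.$$ Then there exists $u\in W^{1,\infty}_{loc}(\mathbb R^2;\mathbb R^2)$ such that (H1) $u$ is affine on $T_i$ for every $i=1,\dots,2n$; (H2) $u(x)=x$ on $\mathbb R^2\setminus\Omega_n^E$; (H3) $\nabla u(x)\in\bigcup_{P\in\mathcal P_n}SO(2)\,P\,U(a)\,P^T$ for almost every $x\in\Omega_n^E\setminus\Omega_n^I$; (H4) $u(x)=R_*x$ in $\Omega_n^I$, where $R_*\in SO(2)$ is the rotation of angle $\rho_n=\frac{2\pi}{n}(1-2\alpha)$.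
   Context: $\{e_1,e_2\}$ is the standard orthonormal basis of $\mathbb R^2$; rotations are counterclockwise. For $i=1,\dots,n$ set $E_i=r_E\cos(\frac{2\pi}{n}(i-1))e_1+r_E\sin(\frac{2\pi}{n}(i-1))e_2$ and $I_i=r_I\cos(\frac{2\pi}{n}(i-1)+\alpha\frac{2\pi}{n})e_1+r_I\sin(\frac{2\pi}{n}(i-1)+\alpha\frac{2\pi}{n})e_2$, with the conventions $E_{n+1}=E_1$, $I_0=I_n$. $\Omega_n^E$ and $\Omega_n^I$ are the convex hulls of $\{E_1,\dots,E_n\}$ and $\{I_1,\dots,I_n\}$. For $i=1,\dots,2n$, $T_i$ is the open triangle with vertices $E_{(i+1)/2},I_{(i-1)/2},I_{(i+1)/2}$ if $i$ is odd, and $E_{i/2},I_{i/2},E_{1+i/2}$ if $i$ is even. $e_{11}=\frac{I_1-E_1}{|I_1-E_1|}$ and $e_{11}^\perp$ is the unit vector obtained by rotating $e_{11}$ counterclockwise by $\pi/2$. $\mathcal P_n=\mathcal R_1^n\cup\mathcal R_2^n$, where $\mathcal R_1^n$ is the set of rotations by angles $\frac{2\pi j}{n}$, $j=0,\dots,n-1$, and $\mathcal R_2^n=(e_{11}\otimes e_{11}-e_{11}^\perp\otimes e_{11}^\perp)\mathcal R_1^n$. *)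

(* Defs.v *)
From HB Require Import structures.
From mathcomp Require Import all_boot all_order all_algebra.
From mathcomp Require Import all_classical all_reals all_analysis.
Import Order.TTheory GRing.Theory Num.Theory.
Import numFieldNormedType.Exports.

Set Implicit Arguments.
Unset Strict Implicit.
Unset Printing Implicit Defensive.

Local Open Scope classical_set_scope.
Local Open Scope ring_scope.

(* Points of the plane are column vectors; the library's norm on 'cV[R]_2 is
   the sup norm, so the Euclidean one is defined here. *)
Definition vec2 (R : realType) (x y : R) : 'cV[R]_2 :=
  \col_(i < 2) (if i == 0 then x else y).

Definition e_ (R : realType) (j : 'I_2) : 'cV[R]_2 := delta_mx j 0.

Definition enorm (R : realType) (v : 'cV[R]_2) : R :=
  Num.sqrt (\sum_(i < 2) v i 0 ^+ 2).

Definition outer (R : realType) (v w : 'cV[R]_2) : 'M[R]_2 := v *m w^T.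

(* Counterclockwise rotation of angle t. *)
Definition rotmx (R : realType) (t : R) : 'M[R]_2 :=
  \matrix_(i < 2, j < 2)
    (if i == j then cos t else if i == 0 then - sin t else sin t).

Definition SO2 (R : realType) : set 'M[R]_2 :=
  [set Q | Q^T *m Q = 1%:M /\ \det Q = 1].

Definition convex_hull (R : realType) (A : set 'cV[R]_2) : set 'cV[R]_2 :=
  smallest (fun C : set 'cV[R]_2 => convex_set C) A.

Definition open_triangle (R : realType) (A B C : 'cV[R]_2) : set 'cV[R]_2 :=
  (convex_hull [set A; B; C])°.

Definition affine_on (R : realType) (D : set 'cV[R]_2)
    (u : 'cV[R]_2 -> 'cV[R]_2) : Prop :=
  exists (A : 'M[R]_2) (b : 'cV[R]_2), forall x, D x -> u x = A *m x + b.

(* Lebesgue measure on the plane is the product measure on R * R, and functions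
   on 'cV[R]_2 are pulled back along [pt]. *)
Definition pt (R : realType) (p : R * R) : 'cV[R]_2 := vec2 p.1 p.2.

Definition leb2 (R : realType) :
    {measure set (measurableTypeR R * measurableTypeR R) -> \bar R} :=
  (@lebesgue_measure R \x @lebesgue_measure R)%E.
Arguments leb2 R : clear implicits.

Definition Linfty_loc (R : realType) (f : 'cV[R]_2 -> R) : Prop :=
  measurable_fun [set: measurableTypeR R * measurableTypeR R] (f \o @pt R) /\
  forall K : set 'cV[R]_2, compact K ->
    finite_norm (leb2 R) +oo%E ((f \_ K) \o @pt R).

Definition iter_partial (R : realType) (s : seq 'I_2) (phi : 'cV[R]_2 -> R) :
    'cV[R]_2 -> R :=
  foldr (fun j (g : 'cV[R]_2 -> R) => fun x => 'D_(e_ R j) g x) phi s.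

(* C^oo: every iterated partial derivative is continuous and can be
   differentiated once more in each coordinate direction. *)
Definition smooth (R : realType) (phi : 'cV[R]_2 -> R) : Prop :=
  forall s : seq 'I_2, continuous (iter_partial s phi) /\
    forall x (j : 'I_2), derivable (iter_partial s phi) x (e_ R j).

Definition test_function (R : realType) (phi : 'cV[R]_2 -> R) : Prop :=
  smooth phi /\ compact (closure [set x | phi x != 0]).

Definition weak_partial (R : realType) (j : 'I_2) (f g : 'cV[R]_2 -> R) : Prop :=
  forall phi, test_function phi ->
    (\int[leb2 R]_p (f (pt p) * 'D_(e_ R j) phi (pt p))%:E =
     - \int[leb2 R]_p (g (pt p) * phi (pt p))%:E)%E.

(* u belongs to W^{1,oo}_loc(R^2; R^2) and Du is its weak gradient, which is
   determined by u up to a null set; (Du x) i j is the j-th weak partial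
   derivative of the i-th component of u. *)
Definition W1oo_loc (R : realType) (u : 'cV[R]_2 -> 'cV[R]_2)
    (Du : 'cV[R]_2 -> 'M[R]_2) : Prop :=
  forall i : 'I_2, Linfty_loc (fun x => u x i 0) /\
    forall j : 'I_2, Linfty_loc (fun x => Du x i j) /\
      weak_partial j (fun x => u x i 0) (fun x => Du x i j).

Definition Ept (R : realType) (n : nat) (rE : R) (i : nat) : 'cV[R]_2 :=
  (rE * cos (2 * pi / n%:R * (i%:R - 1))) *: e_ R 0 +
  (rE * sin (2 * pi / n%:R * (i%:R - 1))) *: e_ R 1.

Definition Ipt (R : realType) (n : nat) (alpha rI : R) (i : nat) : 'cV[R]_2 :=
  (rI * cos (2 * pi / n%:R * (i%:R - 1) + alpha * (2 * pi / n%:R))) *: e_ R 0 +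
  (rI * sin (2 * pi / n%:R * (i%:R - 1) + alpha * (2 * pi / n%:R))) *: e_ R 1.

(* The conventions E_{n+1} = E_1 and I_0 = I_n hold by periodicity. *)
Lemma Ept_wrap (R : realType) (n : nat) (rE : R) :
  (0 < n)%N -> Ept n rE n.+1 = Ept n rE 1.
Proof.
move=> n0; rewrite /Ept; have -> : n.+1%:R - 1 = n%:R :> R.
  by rewrite -[n.+1%:R]natr1 addrK.
rewrite subrr mulr0 divfK ?pnatr_eq0 -?lt0n// mulr_natl.
by rewrite cos2pi sin2pi cos0 sin0.
Qed.

Lemma Ipt_wrap (R : realType) (n : nat) (alpha rI : R) :
  (0 < n)%N -> Ipt n alpha rI 0 = Ipt n alpha rI n.
Proof.
move=> n0; rewrite /Ipt sub0r.
set t := 2 * pi / n%:R.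
have -> : t * (n%:R - 1) + alpha * t = t * -1 + alpha * t + pi *+ 2.
  rewrite mulrBr mulr1 mulrN1 [t * n%:R]divfK ?pnatr_eq0 -?lt0n// -mulr_natl.
  by rewrite -[pi *+ 2]mulr_natl mulr1 [RHS]addrC addrA.
by rewrite cosD2pi sinD2pi.
Qed.

Definition OmegaE (R : realType) (n : nat) (rE : R) : set 'cV[R]_2 :=
  convex_hull [set Ept n rE i | i in [set i | (1 <= i <= n)%N]].

Definition OmegaI (R : realType) (n : nat) (alpha rI : R) : set 'cV[R]_2 :=
  convex_hull [set Ipt n alpha rI i | i in [set i | (1 <= i <= n)%N]].

Definition Ttri (R : realType) (n : nat) (alpha rE rI : R) (i : nat) :
    set 'cV[R]_2 :=
  if odd i then
    open_triangle (Ept n rE i.+1./2) (Ipt n alpha rI i.-1./2)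
                  (Ipt n alpha rI i.+1./2)
  else
    open_triangle (Ept n rE i./2) (Ipt n alpha rI i./2) (Ept n rE (1 + i./2)).

Definition e11 (R : realType) (n : nat) (alpha rE rI : R) : 'cV[R]_2 :=
  let v := Ipt n alpha rI 1 - Ept n rE 1 in (enorm v)^-1 *: v.

Definition e11p (R : realType) (n : nat) (alpha rE rI : R) : 'cV[R]_2 :=
  rotmx (pi / 2) *m e11 n alpha rE rI.

Definition R1set (R : realType) (n : nat) : set 'M[R]_2 :=
  [set rotmx (2 * pi * j%:R / n%:R) | j in [set j : nat | (j < n)%N]].

Definition R2set (R : realType) (n : nat) (alpha rE rI : R) : set 'M[R]_2 :=
  let e := e11 n alpha rE rI in let e' := e11p n alpha rE rI in
  [set (outer e e - outer e' e') *m P | P in @R1set R n].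

Definition Pset (R : realType) (n : nat) (alpha rE rI : R) : set 'M[R]_2 :=
  @R1set R n `|` R2set n alpha rE rI.

Definition Umx (R : realType) (n : nat) (alpha rE rI a : R) : 'M[R]_2 :=
  let e := e11 n alpha rE rI in let e' := e11p n alpha rE rI in
  let phi := (n%:R - 2) * pi / (2 * n%:R) in
  a *: outer e e + a^-1 *: outer e' e' + ((a^-1 - a) / tan phi) *: outer e e'.

Definition wells (R : realType) (n : nat) (alpha rE rI a : R) : set 'M[R]_2 :=
  \bigcup_(P in Pset n alpha rE rI)
    [set Q *m P *m Umx n alpha rE rI a *m P^T | Q in @SO2 R].

(* Main.v *)
Require Import Defs.
From HB Require Import structures.
From mathcomp Require Import all_boot all_order all_algebra.
From mathcomp Require Import all_classical all_reals all_analysis.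
From mathcomp Require Import measurable_realfun ess_sup_inf.
From mathcomp Require Import ring lra.
Import Order.TTheory GRing.Theory Num.Theory.
Import numFieldNormedType.Exports.

(** Why the theorem holds. Put t = pi/n, b = 2 t alpha, b' = 2 t - b and
    d = t - b, and let R be the rotation of angle 2 d = rho_n. The reflection
    in the axis of E_i exchanges I_i and R I_(i-1), and also I_(i-1) and R I_i. Hence the
    piecewise affine map that fixes the E_i and sends each I_i to R I_i
    carries the triangle E_i I_(i-1) I_i onto its mirror image, with the two
    edges at E_i exchanged. It also carries E_i I_i E_(i+1) onto its mirror image
    in the bisector of E_i E_(i+1), with the two edges at I_i exchanged. The ratio
    of the radii makes these two edges meet at an angle pi/2 - pi/n or pi/2 + pi/n,
    and a is the ratio of their lengths ([other_edge], [edge_third]). Now U(a)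
    is the linear map that stretches e_11 by a and the direction at angle phi
    from e_11 by 1/a, so the map is U(a) on the triangles at the outer
    vertices, and its reflection in the line of e_11 on the triangles along the
    outer edges, up to rotations ([two_stretches], [two_stretches_reflected]).

    The map is written as u(x) = R x + (1 - R) V(x), where V interpolates
    the values V(E_i) = E_i and V(I_i) = 0, vanishes on the inner polygon and is
    the identity outside the outer one. Instead of gluing affine pieces, V is
    defined by one formula on the whole plane: a sum of 2 n vectors E_i and I_i
    weighted by tents, each tent being the positive part of a minimum of affine
    functions ([interpolant]). So V is Lipschitz for free. The support of a tent
    lies in one sector of the plane, sectors of different indices do not overlap
    ([sector_unique]), and in the sector between E_i and I_i, or between I_i and
    E_(i+1), at most two tents survive, whose values are read off in the frame of
    the two bounding directions ([interpolantL], [interpolantR]).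

    For the Sobolev statement, a Lipschitz function that is affine near almost
    every point has its pointwise gradient as weak gradient: difference quotients
    satisfy the integration by parts formula exactly, by translation invariance
    of Lebesgue measure, and both sides pass to the limit by dominated
    convergence ([weak_partial_lipschitz]). The exceptional points of u lie on
    finitely many lines, which are null sets. *)
Local Open Scope classical_set_scope.
Local Open Scope ring_scope.
Set Implicit Arguments.
Unset Strict Implicit.
Unset Printing Implicit Defensive.

Local Notation plane R := (measurableTypeR R * measurableTypeR R)%type.

(** * Coordinates and Lebesgue measure on the plane *)
Section Plane.
Context {R : realType}.
Implicit Types (x y : 'cV[R]_2) (p : plane R).

Lemma vec2E0 (a b : R) : vec2 a b 0 0 = a. Proof. by rewrite mxE. Qed.
Lemma vec2E1 (a b : R) : vec2 a b 1 0 = b. Proof. by rewrite mxE. Qed.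

Lemma cV2P x y : x 0 0 = y 0 0 -> x 1 0 = y 1 0 -> x = y.
Proof.
move=> h0 h1; apply/matrixP => i j; rewrite (ord1 j).
case: i => -[|[|//]] Hi.
  by rewrite (_ : Ordinal Hi = 0)//; apply/val_inj.
by rewrite (_ : Ordinal Hi = 1)//; apply/val_inj.
Qed.

Lemma cV2_ball x y e : 0 < e -> `|x 0 0 - y 0 0| < e -> `|x 1 0 - y 1 0| < e ->
  ball x e y.
Proof.
move=> e0 h0 h1; split=> // i j; rewrite (ord1 j).
case: i => -[|[|//]] Hi.
  by rewrite (_ : Ordinal Hi = 0)//; apply/val_inj.
by rewrite (_ : Ordinal Hi = 1)//; apply/val_inj.
Qed.

Lemma coord_le_norm x i : `|x i 0| <= `|x|.
Proof.
suff : forall e, 0 < e -> `|x i 0| <= `|x| + e.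
  by move=> h; apply/ler_addgt0Pr => e /h.
move=> e e0; apply/ltW.
have : ball (0 : 'cV[R]_2) (`|x| + e) x.
  by rewrite mx_norm_ball /ball_ /= sub0r normrN ltrDl.
by move=> [_ /(_ i 0)]; rewrite /ball /= mxE sub0r normrN.
Qed.

Lemma norm_cV2_le x : `|x| <= `|x 0 0| + `|x 1 0|.
Proof.
apply/ler_addgt0Pr => e e0; apply/ltW.
have : ball (0 : 'cV[R]_2) (`|x 0 0| + `|x 1 0| + e) x.
  apply: cV2_ball; rewrite ?mxE ?sub0r ?normrN.
  - by rewrite ltr_wpDl// addr_ge0.
  - by rewrite -addrA ltrDl ltr_wpDl.
  - by rewrite (addrC `|x 0 0|) -addrA ltrDl ltr_wpDl.
by rewrite mx_norm_ball /ball_ /= sub0r normrN.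
Qed.

Definition translate (v : R * R) (p : plane R) : plane R :=
  ((p.1 : R) + v.1, (p.2 : R) + v.2).

Lemma pt_translate (v : R * R) p : pt (translate v p) = pt p + pt v.
Proof. by apply: cV2P; rewrite !mxE. Qed.

(** An open set of the plane is the union of the rational boxes inside it. *)
Lemma measurable_open_pt (U : set 'cV[R]_2) : open U ->
  measurable ((@pt R) @^-1` U : set (plane R)).
Proof.
move=> oU.
pose box (q r : rat) (k : nat) : set (plane R) :=
  `](ratr q - k.+1%:R^-1 : R), ratr q + k.+1%:R^-1[%classic `*`
  `](ratr r - k.+1%:R^-1 : R), ratr r + k.+1%:R^-1[%classic.
pose F q r k : set (plane R) :=
  if `[< box q r k `<=` (@pt R) @^-1` U >] then box q r k else set0.
have -> : (@pt R) @^-1` U = \bigcup_q \bigcup_r \bigcup_k F q r k.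
  suff main (a b : R) : U (pt (a, b)) ->
      (\bigcup_q \bigcup_r \bigcup_k F q r k) (a, b).
    apply/seteqP; split => [[a b]|p [q _] [r _] [k _]]; first exact: main.
    by rewrite /F; case: asboolP => // h; exact: h.
  move=> Up.
  have /nbhs_ballP[e /= e0 eU] : nbhs (pt (a, b)) U by exact: open_nbhs_nbhs.
  have [k hk] := @ltr_add_invr R 0 (e / 2) ltac:(by rewrite divr_gt0).
  rewrite add0r in hk.
  have k0 : (0 : R) < k.+1%:R^-1 by rewrite invr_gt0.
  pose w : R := k.+1%:R^-1; rewrite -/w in hk k0.
  have [q q1] : exists q : rat, ratr q \in `](a - w), a + w[.
    by apply: rat_in_itvoo; lra.
  have [r r1] : exists q : rat, ratr q \in `](b - w), b + w[.
    by apply: rat_in_itvoo; lra.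
  rewrite !in_itv/= in q1 r1.
  exists q => //; exists r => //; exists k => //; rewrite /F.
  case: asboolP => [_|h]; first by split; rewrite /= in_itv/= -/w; lra.
  suff main (z1 z2 : R) : box q r k (z1, z2) -> U (pt (z1, z2)).
    by exfalso; apply: h => -[z1 z2]; exact: main.
  case=> /=; rewrite !in_itv/= -/w => hz1 hz2.
  apply: eU; apply: cV2_ball => //; rewrite ?vec2E0 ?vec2E1/= ltr_norml; lra.
apply: bigcupT_measurable_rat => q; apply: bigcupT_measurable_rat => r.
apply: bigcupT_measurable => k; rewrite /F; case: asboolP => // _.
by apply: measurableX; exact: measurable_itv.
Qed.

Lemma continuous_measurable_pt (f : 'cV[R]_2 -> R) : continuous f ->
  measurable_fun [set: plane R] (f \o @pt R).
Proof.
move=> cf; apply: (measurability _ (RGenOpens.measurableE R)) => //.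
move=> _ [_ [a [b ->] <-]]; rewrite setTI.
rewrite comp_preimage; apply: measurable_open_pt.
by apply: open_comp => // x _; exact: cf.
Qed.

Lemma measurable_plane_shift (v : R * R) :
  measurable_fun [set: plane R] (translate v).
Proof.
apply: measurable_fun_pair; apply: measurable_funD => //.
Qed.

Lemma lebesgue_measure_shift (a : R) (A : set (measurableTypeR R)) :
  measurable A -> lebesgue_measure ((fun x : R => x + a) @^-1` A) = lebesgue_measure A.
Proof.
move=> mA.
pose f (x : measurableTypeR R) : measurableTypeR R := x + a.
have mf : measurable_fun [set: measurableTypeR R] f by exact: measurable_funD.
apply/esym/(@lebesgue_measure_unique _ (pushforward lebesgue_measure f)) => //=.
move=> _ [[c b]] _ <-.
rewrite /pushforward.
have -> : (fun x : R => x + a) @^-1` `]c, b]%classic = `](c - a), b - a]%classic.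
  by apply/seteqP; split => z /=; rewrite !in_itv/=; lra.
rewrite !lebesgue_measure_itv/= !lte_fin ltrD2r; case: ifPn => // _.
by rewrite -!EFinD; congr (_%:E); ring.
Qed.

(** A translate of the product measure has the same values on rectangles, hence
    equals it. *)
Lemma leb2_translate (v : R * R) (A : set (plane R)) : measurable A ->
  leb2 R (translate v @^-1` A) = leb2 R A.
Proof.
move=> mA; apply/esym.
apply: (@product_measure_unique _ _ _ _ _ lebesgue_measure lebesgue_measure
  (pushforward (leb2 R) (translate v))) => //=.
  exact: measurable_plane_shift.
move=> ms C D mC mD; rewrite /pushforward.
have -> : translate v @^-1` (C `*` D) =
    ((fun x : R => x + v.1) @^-1` C) `*` ((fun x : R => x + v.2) @^-1` D) by [].
have m w : measurable_fun [set: measurableTypeR R]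
    (fun x : measurableTypeR R => x + w : measurableTypeR R).
  exact: measurable_funD.
rewrite /leb2 product_measure1E//.
- by congr (_ * _)%E; exact: lebesgue_measure_shift.
- by have := m v.1 measurableT _ mC; rewrite setTI.
- by have := m v.2 measurableT _ mD; rewrite setTI.
Qed.

Lemma integral_leb2_translate (v : R * R) (f : plane R -> \bar R) :
  (leb2 R).-integrable setT f ->
  (\int[leb2 R]_p f (translate v p) = \int[leb2 R]_p f p)%E.
Proof.
move=> intf; have mf := measurable_int _ intf.
have ms := measurable_plane_shift v.
have E g : (\int[pushforward (leb2 R) (translate v)]_p g p = \int[leb2 R]_p g p)%E.
  by apply: eq_measure_integral => A mA _; exact: leb2_translate.
rewrite -[RHS]E integral_pushforward//.
rewrite preimage_setT; apply/integrableP; split.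
  exact: measurableT_comp.
move/integrableP : intf => [_]; rewrite -(E (fun p => `|f p|%E)).
rewrite ge0_integral_pushforward//.
by apply: measurableT_comp.
Qed.

(** When [b != 0], the section over each first coordinate is a point; when
    [b = 0], the set is a vertical line or is empty. *)
Lemma leb2_null_line (a b c : R) : [|| a != 0, b != 0 | c != 0] ->
  leb2 R [set p | a * p.1 + b * p.2 + c = 0] = 0%E.
Proof.
have mA : measurable ([set p | a * p.1 + b * p.2 + c = 0] : set (plane R)).
  have mf : measurable_fun [set: plane R] (fun p : plane R => a * p.1 + b * p.2 + c).
    apply: measurable_funD => //; apply: measurable_funD => //.
    by apply: measurable_funM. by apply: measurable_funM.
  rewrite (_ : mkset _ = (fun p : plane R => a * p.1 + b * p.2 + c) @^-1` [set 0])//.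
  by have := mf measurableT _ (measurable_set1 0); rewrite setTI.
have [->|b0] := eqVneq b 0; have [->|a0] := eqVneq a 0; rewrite /= => c0.
- rewrite (_ : mkset _ = set0) ?measure0//; apply/seteqP; split => // p /=.
  by rewrite !mul0r !add0r; exact/eqP.
- rewrite (_ : mkset _ = [set (- c / a : R)] `*` setT).
    by rewrite /leb2 product_measure1E//= lebesgue_measure_set1 mul0e.
  apply/seteqP; split => -[z w] /=; rewrite mul0r addr0.
    by move=> /eqP; rewrite addr_eq0 => /eqP e; split => //; rewrite -e mulrAC mulfV// mul1r.
  by move=> [-> _]; rewrite mulrCA mulfV// mulr1 addNr.
all: rewrite /leb2 /= /product_measure1 integral0_eq// => /= z _.
- have -> : xsection [set p | 0 * p.1 + b * p.2 + c = 0] z = [set (- c / b : R)].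
    apply/seteqP; split => w; rewrite /xsection /= inE/= mul0r add0r.
      by move=> /eqP; rewrite addr_eq0 => /eqP <-; rewrite mulrAC mulfV// mul1r.
    by move=> ->; rewrite mulrCA mulfV// mulr1 addNr.
  exact: lebesgue_measure_set1.
- have -> : xsection [set p | a * p.1 + b * p.2 + c = 0] z = [set ((- c - a * z) / b : R)].
    apply/seteqP; split => w; rewrite /xsection /= inE/=.
      move=> h; rewrite (_ : - c - a * z = w * b) ?mulfK//.
      by apply/eqP; rewrite -subr_eq0 -oppr_eq0 -h; apply/eqP; ring.
    by move=> ->; rewrite mulrCA mulfV// mulr1; ring.
  exact: lebesgue_measure_set1.
Qed.

End Plane.

(** * Weak derivatives of Lipschitz functions *)
Section WeakDerivative.
Context {R : realType}.
Implicit Types (f phi : 'cV[R]_2 -> R) (p : plane R).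

Lemma norm_e (j : 'I_2) : `|e_ R j| <= 1.
Proof.
apply: le_trans (norm_cV2_le _) _; rewrite !mxE !eqxx !andbT.
by case: j => -[|[|//]] ?; rewrite /= !(normr0, normr1) ?addr0 ?add0r.
Qed.

Definition box (B : R) : set (plane R) :=
  `[- B, B]%classic `*` `[- B, B]%classic.

Lemma measurable_box B : measurable (box B).
Proof. by apply: measurableX; exact: measurable_itv. Qed.

Lemma leb2_box_lty B : (leb2 R (box B) < +oo)%E.
Proof.
pose I : set (measurableTypeR R) := `[- B, B]%classic.
have -> : leb2 R (box B) = (lebesgue_measure I * lebesgue_measure I)%E.
  by apply: product_measure1E; exact: measurable_itv.
rewrite lte_mul_pinfty//; first by
  rewrite ge0_fin_numE// lebesgue_measure_itv/=; case: ifP => _; rewrite ?ltry.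
by rewrite lebesgue_measure_itv/=; case: ifP => _; rewrite ?ltry.
Qed.

Lemma box_norm B p : `|pt p| <= B -> box B p.
Proof.
move=> h; split; rewrite /= in_itv/= -ler_norml.
  by have := coord_le_norm (pt p) 0; rewrite vec2E0 => /le_trans; exact.
by have := coord_le_norm (pt p) 1; rewrite vec2E1 => /le_trans; exact.
Qed.

Lemma box_norm_le B p : box B p -> `|pt p| <= 2 * B.
Proof.
move=> [] /=; rewrite !in_itv/= -!ler_norml => h1 h2.
apply: le_trans (norm_cV2_le _) _; rewrite vec2E0 vec2E1.
by rewrite mulr_natl mulr2n lerD.
Qed.

Lemma integrable_box (g : plane R -> R) (M B : R) :
  measurable_fun setT g -> (forall p, box B p -> `|g p| <= M) ->
  (forall p, g p != 0 -> box B p) ->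
  (leb2 R).-integrable setT (EFin \o g).
Proof.
move=> mg gM gB.
have -> : EFin \o g = (EFin \o g) \_ (box B).
  apply/funext => p; rewrite /patch; case: ifPn => // h /=.
  by congr (_%:E); apply/eqP; apply: contraNT h => /gB h; rewrite inE.
apply/(integrable_mkcond _ (measurable_box B)).
apply: measurable_bounded_integrable; first exact: measurable_box.
- exact: leb2_box_lty.
- exact: measurable_funTS.
- exists M; split; first exact: num_real.
  by move=> N MN p Bp; exact: le_trans (gM p Bp) (ltW MN).
Qed.

Lemma derive_line phi x v t : derivable phi (x + t *: v) v ->
  is_derive t 1 (fun s : R => phi (x + s *: v)) ('D_v phi (x + t *: v)).
Proof.
have E : (fun h : R => h^-1 *: (((fun s => phi (x + s *: v)) \o shift t) (h *: 1)
     - phi (x + t *: v))) =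
  (fun h : R => h^-1 *: ((phi \o shift (x + t *: v)) (h *: v) - phi (x + t *: v))).
  by apply/funext => h; rewrite /= [h *: 1]mulr1 scalerDl addrCA.
move=> d; apply: DeriveDef; first by rewrite /derivable E.
by rewrite /derive E.
Qed.

(** Applied to a test function, this bounds its difference quotients uniformly,
    as dominated convergence requires. *)
Lemma derive_mvt phi x v (h M : R) : 0 <= h -> continuous phi ->
  (forall y, derivable phi y v) -> (forall y, `|'D_v phi y| <= M) ->
  `|phi (x + h *: v) - phi x| <= M * h.
Proof.
move=> h0 cphi dphi M1.
have [||c _] := @MVT_segment _ (fun s : R => phi (x + s *: v))
    (fun s => 'D_v phi (x + s *: v)) 0 h h0.
- by move=> s _; exact: derive_line.
- apply: continuous_subspaceT => s.
  apply: differentiable_continuous; apply/derivable1_diffP.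
  by have [] := derive_line (dphi (x + s *: v)).
- by rewrite /= scale0r addr0 subr0 => ->; rewrite normrM (ger0_norm h0) ler_wpM2r.
Qed.

Lemma bounded_continuous_support f (K : set 'cV[R]_2) : compact K ->
  continuous f -> (forall x, ~ K x -> f x = 0) ->
  exists2 M : R, 0 <= M & forall x, `|f x| <= M.
Proof.
move=> cK cf f0.
have /compact_bounded[M [Mr hM]] : compact (f @` K).
  by apply: continuous_compact => //; exact: continuous_subspaceT.
exists (`|M| + 1) => [|x]; first by rewrite addr_ge0.
have [Kx|/f0 ->] := pselect (K x); last by rewrite normr0 addr_ge0.
apply: (hM (`|M| + 1)); last by exists x.
by rewrite (le_lt_trans (ler_norm _))// ltrDl.
Qed.

(** The partial derivative vanishes off the support of [phi] because [phi] is
    zero in a neighbourhood of each such point; so it is bounded like [phi]. *)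
Lemma test_function_bound phi (j : 'I_2) : test_function phi ->
  exists M B : R, [/\ 0 <= M, 0 <= B, forall x, `|phi x| <= M,
    forall x, `|'D_(e_ R j) phi x| <= M & forall x, phi x != 0 -> `|x| <= B].
Proof.
move=> [sphi cK].
have K0 x : ~ closure [set x | phi x != 0] x -> phi x = 0.
  by move=> h; apply/eqP; apply: contra_notT h => h; exact: subset_closure.
have [M1 M10 hM1] := bounded_continuous_support cK (sphi [::]).1 K0.
have [|M2 M20 hM2] := bounded_continuous_support cK (sphi [:: j]).1.
  move=> x Kx /=; rewrite (@near_eq_derive _ _ _ _ (cst 0)) ?derive_cst//.
  have oK : open (~` closure [set x | phi x != 0]).
    by apply: closed_openC; exact: closed_closure.
  by apply: filterS (open_nbhs_nbhs (conj oK Kx)) => y /K0.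
have /compact_bounded[B [Br hB]] := cK.
exists (Num.max M1 M2), (`|B| + 1); split.
- by rewrite le_max M10.
- by rewrite addr_ge0.
- by move=> x; rewrite le_max hM1.
- by move=> x; rewrite le_max; apply/orP; right; exact: hM2.
- move=> x hx; apply: (hB (`|B| + 1)); last exact: subset_closure.
  by rewrite (le_lt_trans (ler_norm _))// ltrDl.
Qed.

Lemma dominated_convergence_box (u : nat -> plane R -> R) (v : plane R -> R) (C B : R) :
  (forall k, measurable_fun setT (u k)) -> measurable_fun setT v ->
  {ae leb2 R, forall p, u ^~ p @ \oo --> v p} ->
  (forall k p, box B p -> `|u k p| <= C) ->
  (forall k p, u k p != 0 -> box B p) ->
  (fun k => \int[leb2 R]_p (u k p)%:E)%E @ \oo --> (\int[leb2 R]_p (v p)%:E)%E.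
Proof.
move=> mu mv uv uC uB.
pose w p : R := `|C| * \1_(box B) p.
have iw : (leb2 R).-integrable setT (EFin \o w).
  apply: (@integrable_box w `|C| B).
  - apply: measurable_funM => //; apply: measurable_indic; exact: measurable_box.
  - move=> p Bp; rewrite /w indicE mem_set// mulr1 normr_id//.
  - move=> p; rewrite /w indicE; have [//|nB] := pselect (box B p).
    by rewrite memNset// mulr0 eqxx.
have mu' k : measurable_fun setT (fun p => (u k p)%:E) by exact/measurable_EFinP.
have mv' : measurable_fun setT (fun p => (v p)%:E) by exact/measurable_EFinP.
have uv' : {ae leb2 R, forall p, setT p -> (fun k => (u k p)%:E) @ \oo --> (v p)%:E}.
  apply: filterS uv => p up _; apply: cvg_EFin; first by apply: nearW => k.
  exact: up.
have uw : {ae leb2 R, forall p k, setT p -> (`|(u k p)%:E| <= (EFin \o w) p)%E}.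
  apply: nearW => p k _ /=; rewrite lee_fin /w indicE.
  have [Bp|nB] := pselect (box B p).
    by rewrite mem_set// mulr1; apply: le_trans (uC k p Bp) (ler_norm _).
  rewrite memNset// mulr0.
  by have [->|/uB//] := eqVneq (u k p) 0; rewrite normr0.
by have [_ _] := dominated_convergence measurableT mu' mv' uv' iw uw.
Qed.

Definition lipschitz_with (L : R) f := forall x y, `|f x - f y| <= L * `|x - y|.

Lemma lipschitz_with_continuous (L : R) f : lipschitz_with L f -> continuous f.
Proof.
move=> lf x; apply/(@cvgrPdist_lt _ _ _ _ (nbhs_filter x)) => e e0.
have L0 : 0 < `|L| + 1 by rewrite ltr_wpDl.
have d0 : 0 < e / (`|L| + 1) by exact: divr_gt0.
apply/nbhs_ballP; exists (e / (`|L| + 1)) => //= y; rewrite mx_norm_ball /ball_ /=.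
rewrite ltr_pdivlMr// mulrC; apply: le_lt_trans.
apply: le_trans (lf x y) _; rewrite ler_wpM2r//.
by apply: le_trans (ler_norm L) _; rewrite lerDl.
Qed.

Lemma lipschitz_with_ge0 (L : R) f : lipschitz_with L f -> 0 <= L.
Proof.
move=> lf; have := le_trans (normr_ge0 _) (lf 0 (e_ R 0)).
rewrite pmulr_lge0// sub0r normrN normr_gt0; apply/eqP => /matrixP/(_ 0 0).
by rewrite !mxE eqxx/= => /eqP; rewrite oner_eq0.
Qed.

(** The steps are [1/(k+1)], so that limits in [k] are limits of sequences, to
    which dominated convergence applies. *)
Definition diffquot (j : 'I_2) f (k : nat) (x : 'cV[R]_2) : R :=
  k.+1%:R * (f (x + k.+1%:R^-1 *: e_ R j) - f x).

Lemma diffquot_le (L : R) j f k x : lipschitz_with L f -> `|diffquot j f k x| <= L.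
Proof.
move=> lf; rewrite /diffquot normrM ger0_norm// mulrC -ler_pdivlMr//.
apply: le_trans (lf _ _) _; rewrite addrAC subrr add0r normrZ.
rewrite ger0_norm ?invr_ge0// mulrA ler_piMr ?norm_e// mulr_ge0 ?invr_ge0//.
exact: lipschitz_with_ge0 lf.
Qed.

Lemma continuous_diffquot j f k : continuous f -> continuous (diffquot j f k).
Proof.
move=> cf x; have FF : Filter (nbhs x) := nbhs_filter x.
apply: cvgM; first exact: cvg_cst.
apply: cvgB; last exact: cf.
apply: continuous_comp; last exact: cf.
by apply: cvgD; [exact: cvg_id|exact: cvg_cst].
Qed.

(** Moving the translation from [phi] to [f] turns the backward quotients of
    [phi] into the opposite of the forward quotients of [f]. The former converge
    because [phi] is differentiable, the latter by hypothesis, and both are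
    bounded on a box that contains all supports. *)
Lemma weak_partial_lipschitz (L : R) (j : 'I_2) f (g : 'cV[R]_2 -> R) :
  lipschitz_with L f -> measurable_fun [set: plane R] (g \o @pt R) ->
  {ae leb2 R, forall p, diffquot j f ^~ (pt p) @ \oo --> g (pt p)} ->
  weak_partial j f g.
Proof.
move=> lf mg fg phi tphi.
have [M [B [M0 B0 phiM dphiM phiB]]] := test_function_bound j tphi.
have cf := lipschitz_with_continuous lf.
have cphi : continuous phi := (tphi.1 [::]).1.
have cdphi : continuous ('D_(e_ R j) phi) := (tphi.1 [:: j]).1.
have dphi x : derivable phi x (e_ R j) := (tphi.1 [::]).2 x j.
pose h (k : nat) : R := k.+1%:R^-1.
have h0 k : 0 < h k by rewrite invr_gt0.
have h1 k : h k <= 1 by rewrite invf_le1// ler1n.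
pose psi k x : R := k.+1%:R * (phi x - phi (x - h k *: e_ R j)).
have cpsi k : continuous (psi k).
  move=> x; have FF : Filter (nbhs x) := nbhs_filter x.
  apply: cvgM; first exact: cvg_cst.
  apply: cvgB; first exact: cphi.
  apply: continuous_comp; last exact: cphi.
  by apply: cvgB; [exact: cvg_id|exact: cvg_cst].
have he k : `|h k *: e_ R j| <= 1.
  by rewrite normrZ gtr0_norm// mulr_ile1// ?norm_e// ltW.
have supp k x : psi k x != 0 -> `|x| <= B + 1.
  have [p0|/phiB xB _] := eqVneq (phi x) 0; last by rewrite (le_trans xB)// lerDl.
  have [p1|/phiB xB _] := eqVneq (phi (x - h k *: e_ R j)) 0.
    by rewrite /psi p0 p1 subrr mulr0 eqxx.
  rewrite -[x](subrK (h k *: e_ R j)).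
  by apply: le_trans (ler_normD _ _) _; exact: lerD.
have suppphi x : phi x != 0 -> `|x| <= B + 1.
  by move=> /phiB xB; rewrite (le_trans xB)// lerDl.
pose C := `|f 0| + L * (2 * (B + 1)).
have fC p : box (B + 1) p -> `|f (pt p)| <= C.
  move=> /box_norm_le pB; rewrite -[f _](subrK (f 0)) addrC.
  apply: le_trans (ler_normD _ _) _; rewrite lerD2l.
  apply: le_trans (lf _ _) _; rewrite subr0 ler_wpM2l//.
  exact: lipschitz_with_ge0 lf.
have C0 : 0 <= C.
  by rewrite addr_ge0// mulr_ge0 ?(lipschitz_with_ge0 lf)// mulr_ge0// addr_ge0.
have psiM k x : `|psi k x| <= M.
  rewrite /psi normrM ger0_norm// mulrC -ler_pdivlMr//.
  rewrite -{1}[x](subrK (h k *: e_ R j)).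
  exact: derive_mvt (ltW (h0 k)) cphi dphi dphiM.
(* [psi k] is the difference quotient of [phi] of step [- h k] *)
have psi_cvg x : psi ^~ x @ \oo --> 'D_(e_ R j) phi x.
  have /(cvgr_dnbhsP _ _ _).1 := dphi x.
  move=> /(_ (fun k => - h k)) H.
  have -> : psi ^~ x = (fun n => (- h n)^-1 *: ((phi \o shift x) (- h n *: e_ R j) - phi x)).
    apply/funext => k /=.
    by rewrite invrN scaleNr -scalerN opprB invrK scaleNr (addrC _ x).
  apply: H; split => [n|]; first by rewrite oppr_eq0 gt_eqF.
  by rewrite -oppr0; apply: cvgN; exact: cvg_harmonic.
have mc (w : 'cV[R]_2 -> R) : continuous w ->
    measurable_fun setT (fun p : plane R => w (pt p)).
  by move=> cw; exact: continuous_measurable_pt.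
have lim1 : (fun k => \int[leb2 R]_p (f (pt p) * psi k (pt p))%:E)%E @ \oo -->
    (\int[leb2 R]_p (f (pt p) * 'D_(e_ R j) phi (pt p))%:E)%E.
  apply: (@dominated_convergence_box _ _ (C * M) (B + 1)).
  - by move=> k; apply: measurable_funM; apply: mc.
  - by apply: measurable_funM; [exact: (mc _ cf)|exact: (mc _ cdphi)].
  - by apply: nearW => p; exact: (cvgMl_tmp (psi_cvg (pt p))).
  - by move=> k p pB; rewrite normrM ler_pM//; exact: fC.
  - move=> k p; rewrite mulf_eq0 negb_or => /andP[_ /supp]; exact: box_norm.
have lim2 : (fun k => \int[leb2 R]_p (diffquot j f k (pt p) * phi (pt p))%:E)%E @ \oo -->
    (\int[leb2 R]_p (g (pt p) * phi (pt p))%:E)%E.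
  apply: (@dominated_convergence_box _ _ (L * M) (B + 1)).
  - by move=> k; apply: measurable_funM; apply: mc => //; exact: continuous_diffquot.
  - by apply: measurable_funM => //; exact: mc.
  - by apply: filterS fg => p fgp; exact: (cvgMr_tmp fgp).
  - by move=> k p pB; rewrite normrM ler_pM//; exact: diffquot_le.
  - move=> k p; rewrite mulf_eq0 negb_or => /andP[_ /suppphi]; exact: box_norm.
have step k : (\int[leb2 R]_p (f (pt p) * psi k (pt p))%:E =
    - \int[leb2 R]_p (diffquot j f k (pt p) * phi (pt p))%:E)%E.
  pose v : R * R := (h k * e_ R j 0 0, h k * e_ R j 1 0).
  have vE : pt v = h k *: e_ R j by apply: cV2P; rewrite ?vec2E0 ?vec2E1 /v/= !mxE.
  (* [F] is the term of the left integrand that has [phi] translated, and [H],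
     its translate, has [f] translated instead *)
  pose F p : R := k.+1%:R * f (pt p) * phi (pt p - pt v).
  pose G p : R := k.+1%:R * f (pt p) * phi (pt p).
  pose H p : R := k.+1%:R * f (pt p + pt v) * phi (pt p).
  have cshift (w : 'cV[R]_2 -> R) (z : 'cV[R]_2) : continuous w ->
      continuous (fun x : 'cV[R]_2 => w (x + z)).
    move=> cw x; have FF : Filter (nbhs x) := nbhs_filter x.
    apply: continuous_comp; last exact: cw.
    by apply: cvgD; [exact: cvg_id|exact: cvg_cst].
  have mF : measurable_fun setT F.
    apply: measurable_funM; last exact: (mc _ (cshift _ _ cphi)).
    by apply: measurable_funM => //; exact: mc.
  have mG : measurable_fun setT G.
    apply: measurable_funM; last exact: mc.
    by apply: measurable_funM => //; exact: mc.
  have iF : (leb2 R).-integrable setT (EFin \o F).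
    apply: (@integrable_box F (k.+1%:R * C * M) (B + 1)) => // p.
      move=> pB; rewrite !normrM ler_pM// ?mulr_ge0//.
      by rewrite ger0_norm// ler_pM2l//; exact: fC.
    rewrite mulf_eq0 negb_or => /andP[_ /phiB xB]; apply: box_norm.
    rewrite -[pt p](subrK (pt v)); apply: le_trans (ler_normD _ _) _.
    by rewrite lerD// vE.
  have iG : (leb2 R).-integrable setT (EFin \o G).
    apply: (@integrable_box G (k.+1%:R * C * M) (B + 1)) => // p.
      move=> pB; rewrite !normrM ler_pM// ?mulr_ge0//.
      by rewrite ger0_norm// ler_pM2l//; exact: fC.
    by rewrite mulf_eq0 negb_or => /andP[_ /suppphi xB]; apply: box_norm.
  have HE : H = F \o translate v.
    by apply/funext => p; rewrite /H /F /= pt_translate addrK.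
  have iH : (leb2 R).-integrable setT (EFin \o H).
    apply: (@integrable_box H (k.+1%:R * (C + L) * M) (B + 1)) => [|p|p].
    - apply: measurable_funM; last exact: mc.
      by apply: measurable_funM => //; exact: (mc _ (cshift _ _ cf)).
    - move=> pB; rewrite !normrM ler_pM// ?mulr_ge0//; rewrite ger0_norm// ler_pM2l//.
      rewrite -[f _](subrK (f (pt p))) addrC; apply: le_trans (ler_normD _ _) _.
      rewrite lerD//; first exact: fC.
      apply: le_trans (lf _ _) _; rewrite addrAC subrr add0r ler_piMr ?vE//.
      exact: lipschitz_with_ge0 lf.
    by rewrite mulf_eq0 negb_or => /andP[_ /suppphi xB]; apply: box_norm.
  have FH : (\int[leb2 R]_p (H p)%:E = \int[leb2 R]_p (F p)%:E)%E.
    by rewrite HE; exact: (integral_leb2_translate v iF).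
  have -> : (\int[leb2 R]_p (f (pt p) * psi k (pt p))%:E =
      \int[leb2 R]_p ((G p)%:E - (F p)%:E))%E.
    apply: eq_integral => p _; rewrite -EFinB; congr (_%:E).
    by rewrite /G /F /psi vE; ring.
  have -> : (\int[leb2 R]_p (diffquot j f k (pt p) * phi (pt p))%:E =
      \int[leb2 R]_p ((H p)%:E - (G p)%:E))%E.
    apply: eq_integral => p _; rewrite -EFinB; congr (_%:E).
    by rewrite /G /H /diffquot vE; ring.
  rewrite integralB_EFin// integralB_EFin// FH fin_num_oppeB//.
    by rewrite addeC.
  exact: integrable_fin_num iG.
have lim2N := cvgeN lim2.
have E : (fun k => - \int[leb2 R]_p (diffquot j f k (pt p) * phi (pt p))%:E)%E =
    (fun k => \int[leb2 R]_p (f (pt p) * psi k (pt p))%:E)%E.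
  by apply/funext => k; rewrite step.
rewrite E in lim2N; apply: (@cvg_unique _ (@ereal_hausdorff R) _ _ _ _ lim1).
exact: lim2N.
Qed.

End WeakDerivative.

(** * The weak gradient as a limit of difference quotients *)
Section LipschitzW1oo.
Context {R : realType}.
Implicit Types (f : 'cV[R]_2 -> R) (u : 'cV[R]_2 -> 'cV[R]_2).

(** The upper limit exists everywhere for a Lipschitz [u] and is measurable in
    [x]; it is the gradient at every point near which [u] is affine. *)
Definition weak_gradient u (x : 'cV[R]_2) : 'M[R]_2 :=
  \matrix_(i, j) limn_sup (fun k => diffquot j (fun y => u y i 0) k x).

Definition affine_near u (x : 'cV[R]_2) (A : 'M[R]_2) : Prop :=
  exists b, \forall y \near x, u y = A *m y + b.

Lemma diffquot_affine_near u x A i j : affine_near u x A ->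
  diffquot j (fun y => u y i 0) ^~ x @ \oo --> A i j.
Proof.
move=> [b /nbhs_ballP[e /= e0 uE]]; apply: cvg_near_cst.
have [N _ hN] := near_infty_natSinv_lt (PosNum e0).
exists N => // k /hN /= hk; rewrite /diffquot.
have h0 : (0 : R) < k.+1%:R by rewrite ltr0n.
rewrite uE; last first.
  rewrite mx_norm_ball /ball_ /= opprD addrA subrr add0r normrN normrZ.
  rewrite ger0_norm ?invr_ge0 ?ltW//; apply: le_lt_trans hk.
  by rewrite ler_piMr ?norm_e// invr_ge0 ltW.
rewrite uE; last exact: ballxx.
rewrite mulmxDr -scalemxAr /e_ -colE !mxE.
by rewrite (_ : _ - _ = k.+1%:R^-1 * A i j) ?mulVKf ?gt_eqF//; ring.
Qed.

Lemma weak_gradient_affine u x A : affine_near u x A -> weak_gradient u x = A.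
Proof.
move=> uA; apply/matrixP => i j; rewrite mxE.
have c := diffquot_affine_near (i := i) (j := j) uA.
by rewrite cvg_limn_supE; [exact/cvg_lim|apply/cvg_ex; exists (A i j)].
Qed.

(** On a compact set a pointwise bound also bounds the essential supremum. *)
Lemma Linfty_locP f : measurable_fun [set: plane R] (f \o @pt R) ->
  (forall K, compact K -> exists M : R, forall x, K x -> `|f x| <= M) ->
  Linfty_loc f.
Proof.
move=> mf fK; split=> // K /fK[M fM]; rewrite /finite_norm unlock /Lnorm.
case: ifPn => // _; apply: (@le_lt_trans _ _ `|M|%:E); last exact: ltry.
apply: (@ess_sup_ler _ _ _ (leb2 R)) => p /=; rewrite lee_fin /patch.
case: ifPn => [|_]; last by rewrite normr0.
by rewrite inE => /fM /le_trans; apply; exact: ler_norm.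
Qed.

(** The upper limit of the quotients keeps the bound [L], and agrees with their
    limit at almost every point. *)
Lemma lipschitz_W1oo_loc (L : R) u :
  (forall i, lipschitz_with L (fun x => u x i 0)) ->
  {ae leb2 R, forall p, exists A, affine_near u (pt p) A} ->
  W1oo_loc u (weak_gradient u).
Proof.
move=> lu uA i; have cu := lipschitz_with_continuous (lu i).
split.
  apply: Linfty_locP; first exact: continuous_measurable_pt.
  move=> K cK.
  have /compact_bounded[M [Mr hM]] : compact ((fun x => u x i 0) @` K).
    by apply: continuous_compact => //; exact: continuous_subspaceT.
  exists (`|M| + 1) => x Kx; apply: (hM (`|M| + 1)); last by exists x.
  by rewrite (le_lt_trans (ler_norm _))// ltrDl.
move=> j; pose d x k := diffquot j (fun y => u y i 0) k x.
have dL x k : `|d x k| <= L := diffquot_le j k x (lu i).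
have ubd x : has_ubound (range (d x)).
  by exists L => _ [k _ <-]; apply: le_trans (ler_norm _) (dL x k).
have lbd x : has_lbound (range (d x)).
  by exists (- L) => _ [k _ <-]; have := dL x k; rewrite ler_norml => /andP[].
have mD : measurable_fun [set: plane R] ((fun x => weak_gradient u x i j) \o @pt R).
  have -> : (fun x => weak_gradient u x i j) \o @pt R =
      (fun p => limn_sup (d (pt p))) by apply/funext => p; rewrite /= mxE.
  apply: measurable_fun_limn_sup => [p _|p _|k]; [exact: ubd|exact: lbd|].
  exact: (continuous_measurable_pt (@continuous_diffquot _ j _ k cu)).
split; last first.
  apply: (weak_partial_lipschitz (lu i) mD).
  near=> p.
  have [A uA'] : exists A, affine_near u (pt p) A by near: p; exact: uA.
  rewrite /= (weak_gradient_affine uA').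
  exact: diffquot_affine_near.
apply: Linfty_locP => // K _; exists L => x _; rewrite mxE ler_norml.
have h k : - L <= sups (d x) k <= L.
  have : `|d x k| <= L := dL x k.
  rewrite ler_norml => /andP[l1 _]; apply/andP; split.
    apply: le_trans l1 _; apply: ub_le_sup; last by exists k => /=.
    exact/has_ubound_sdrop/ubd.
  apply: ge_sup; first by exists (d x k); exists k => /=.
  by move=> _ [m _ <-]; apply: le_trans (ler_norm _) (dL x m).
have c : cvgn (sups (d x)) by apply/cvg_ex; eexists; exact: cvg_sups_inf.
rewrite -/(d x); apply/andP; split.
  by apply: limr_ge => //; apply: nearW => k; have /andP[] := h k.
by apply: limr_le => //; apply: nearW => k; have /andP[] := h k.
Unshelve. all: by end_near. Qed.

End LipschitzW1oo.

(** * Directions *)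
Section Directions.
Context {R : realType}.
Implicit Types (x y : 'cV[R]_2) (s : R).

Definition dir s : 'cV[R]_2 := vec2 (cos s) (sin s).

Definition dot_dir s x : R := x 0 0 * cos s + x 1 0 * sin s.

(** Positive iff [x] lies to the left of the line of direction [s]. As a function
    of [s] it is a sine wave of period [2 * pi]. *)
Definition cross_dir s x : R := x 1 0 * cos s - x 0 0 * sin s.

Lemma dot_dir_dir (r s s' : R) : dot_dir s (r *: dir s') = r * cos (s' - s).
Proof. by rewrite /dot_dir cosB !mxE/=; ring. Qed.

Lemma cross_dir_dir (r s s' : R) : cross_dir s (r *: dir s') = r * sin (s' - s).
Proof. by rewrite /cross_dir sinB !mxE/=; ring. Qed.

Lemma dot_dirD s x y : dot_dir s (x + y) = dot_dir s x + dot_dir s y.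
Proof. by rewrite /dot_dir !mxE; ring. Qed.
Lemma dot_dirZ s (r : R) x : dot_dir s (r *: x) = r * dot_dir s x.
Proof. by rewrite /dot_dir !mxE; ring. Qed.
(** Both sides are sine waves in [c] that agree at [c = a] and [c = b]. *)
Lemma cross_dir_three (a b c : R) x :
  cross_dir c x * sin (b - a) = cross_dir a x * sin (b - c) + cross_dir b x * sin (c - a).
Proof. by rewrite /cross_dir !sinB; ring. Qed.

Lemma dot_dir_three (a b c : R) x :
  dot_dir c x * sin (b - a) = cross_dir a x * cos (b - c) - cross_dir b x * cos (a - c).
Proof. by rewrite /dot_dir /cross_dir !sinB !cosB; ring. Qed.

(** Cramer's rule in the frame of two directions. *)
Lemma dir_coord (a b : R) x :
  sin (b - a) *: x = - cross_dir b x *: dir a + cross_dir a x *: dir b.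
Proof.
by apply: cV2P; rewrite !mxE/= /cross_dir sinB; ring.
Qed.

Lemma sin_period (q : int) s : sin (s + 2 * pi * q%:~R) = sin s.
Proof.
have P (k : nat) (a : R) : sin (a + 2 * pi * k%:R) = sin a.
  rewrite (_ : _ * _ = pi *+ 2 *+ k); first exact: (periodicn (@sinD2pi R)).
  by rewrite -mulrnA -[pi *+ _]mulr_natl natrM; ring.
case: q => k; first exact: P.
by rewrite NegzE intrN -[LHS](P k.+1); congr sin; rewrite -pmulrn; ring.
Qed.

Lemma cos_period (q : int) s : cos (s + 2 * pi * q%:~R) = cos s.
Proof. by rewrite -!sinDpihalf addrAC sin_period. Qed.

Lemma dir_period (q : int) s : dir (s + 2 * pi * q%:~R) = dir s.
Proof. by rewrite /dir sin_period cos_period. Qed.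

Lemma dot_dir_period (q : int) s x : dot_dir (s + 2 * pi * q%:~R) x = dot_dir s x.
Proof. by rewrite /dot_dir sin_period cos_period. Qed.

Lemma cross_dir_period (q : int) s x : cross_dir (s + 2 * pi * q%:~R) x = cross_dir s x.
Proof. by rewrite /cross_dir sin_period cos_period. Qed.

Lemma sin_le0_pi s : pi <= s <= 2 * pi -> sin s <= 0.
Proof.
move=> h; rewrite -[s](subrK pi) sinDpi oppr_le0; apply: sin_ge0_pi; lra.
Qed.

Lemma sum_I2 (F : 'I_2 -> R) : \sum_i F i = F 0 + F 1.
Proof.
rewrite big_ord_recl big_ord1 (_ : ord0 = 0 :> 'I_2)//.
by rewrite (_ : lift 0 ord0 = 1 :> 'I_2)//; exact: val_inj.
Qed.

Lemma outer_dir (v : 'cV[R]_2) s x : outer v (dir s) *m x = dot_dir s x *: v.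
Proof.
rewrite /outer -mulmxA [X in v *m X]mx11_scalar mul_mx_scalar; congr (_ *: v).
by rewrite mxE sum_I2 /dot_dir !mxE/=; ring.
Qed.

End Directions.

(** * The sectors of opening 2 pi / n *)
Section Sectors.
Context {R : realType} (n : nat).
Hypothesis n3 : (3 <= n)%N.
Implicit Types (x y : 'cV[R]_2) (s : R).

Definition half_angle : R := pi / n%:R.
Local Notation t := half_angle.

Let n0 : (0 : R) < n%:R. Proof. by rewrite ltr0n; case: n n3. Qed.

Lemma half_angle_n : t * n%:R = pi. Proof. by rewrite /t divfK// gt_eqF. Qed.

Lemma half_angle_gt0 : 0 < t. Proof. by rewrite divr_gt0// pi_gt0. Qed.

Lemma half_angle_le : 3 * t <= pi.
Proof.
by rewrite -half_angle_n mulrC ler_pM2l ?half_angle_gt0// (ler_nat _ 3 n).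
Qed.

Lemma cos_half_angle_gt0 : 0 < cos t.
Proof. by apply: cos_gt0_pihalf; have := half_angle_gt0; have := half_angle_le; lra. Qed.

Lemma sin_half_angle_gt0 : 0 < sin t.
Proof. by apply: sin_gt0_pi; have := half_angle_gt0; have := half_angle_le; lra. Qed.

Lemma sin_half_angle2_gt0 : 0 < sin (2 * t).
Proof. by apply: sin_gt0_pi; have := half_angle_gt0; have := half_angle_le; lra. Qed.

Definition sector_angle (k : int) : R := 2 * t * k%:~R.
Local Notation ang := sector_angle.

Lemma angD (j k : int) : ang (j + k) = ang j + ang k.
Proof. by rewrite /sector_angle intrD mulrDr. Qed.

Lemma ang1 : ang 1 = 2 * t. Proof. by rewrite /sector_angle mulr1. Qed.

Lemma angMn (q : int) : ang (q * n%:Z) = 2 * pi * q%:~R.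
Proof. by rewrite /sector_angle intrM -half_angle_n -pmulrn; ring. Qed.

Lemma ang_modn (k : int) :
  exists (j : 'I_n) (q : int), k = j%:Z + q * n%:Z.
Proof.
have nz : (n%:Z : int) != 0 by case: n n3.
have h1 := ltz_pmod k (isT : true && (0 < n.+1%:Z)%R).
have h0 := modz_ge0 k nz.
have h2 : (k %% n%:Z)%Z < n%:Z by rewrite ltz_pmod// ltz_nat; case: n n3.
case E : (k %% n%:Z)%Z h0 h2 => [j|//] _ h2.
rewrite ltz_nat in h2.
by exists (Ordinal h2), (k %/ n%:Z)%Z; rewrite {1}(divz_eq k n%:Z) E addrC.
Qed.

(** The sign of a sine wave determines its phase: if it is nonnegative at [s] and
    nonpositive at [s + 2 t], it is nonpositive at [s + 2 t m] while
    [2 t m <= pi], and nonnegative at [s + 2 t (m + 1)] afterwards. *)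
Lemma sector_disjoint (m : nat) s x : (0 < m < n)%N ->
  0 <= cross_dir s x -> cross_dir (s + 2 * t) x <= 0 ->
  0 < cross_dir (s + 2 * t * m%:R) x ->
  cross_dir (s + 2 * t * m%:R + 2 * t) x < 0 -> False.
Proof.
move=> /andP[m0 mn] h0 h1 hm hm1.
have s2 := sin_half_angle2_gt0; have t0 := half_angle_gt0; have tpi := half_angle_n.
have m1 : (1 : R) <= m%:R by rewrite ler1n.
have mn1 : (m%:R : R) + 1 <= n%:R by rewrite natr1 ler_nat.
have tm1 : t * 1 <= t * m%:R by rewrite ler_pM2l.
have tmn : t * (m%:R + 1) <= t * n%:R by rewrite ler_pM2l.
have [le|/ltW ge] := leP (2 * t * m%:R) pi.
  have E := cross_dir_three s (s + 2 * t) (s + 2 * t * m%:R) x.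
  have a0 : 0 <= sin (2 * t * m%:R) by apply: sin_ge0_pi; lra.
  have a1 : 0 <= sin (2 * t * m%:R - 2 * t) by apply: sin_ge0_pi; lra.
  rewrite (_ : s + 2 * t - s = 2 * t) in E; last by ring.
  rewrite (_ : s + 2 * t - _ = - (2 * t * m%:R - 2 * t)) in E; last by ring.
  rewrite (_ : s + 2 * t * m%:R - s = 2 * t * m%:R) in E; last by ring.
  rewrite sinN mulrN in E.
  have := mulr_gt0 hm s2; rewrite E ltNge => /negP; apply.
  rewrite -oppr_ge0 opprD opprK addr_ge0//; first exact: mulr_ge0.
  by rewrite -mulNr mulr_ge0// oppr_ge0.
have E := cross_dir_three s (s + 2 * t) (s + 2 * t * m%:R + 2 * t) x.
have a0 : sin (2 * t * m%:R) <= 0 by apply: sin_le0_pi; lra.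
have a1 : sin (2 * t * m%:R + 2 * t) <= 0 by apply: sin_le0_pi; lra.
rewrite (_ : s + 2 * t - s = 2 * t) in E; last by ring.
rewrite (_ : s + 2 * t - _ = - (2 * t * m%:R)) in E; last by ring.
rewrite (_ : s + 2 * t * m%:R + 2 * t - s = 2 * t * m%:R + 2 * t) in E; last by ring.
rewrite sinN in E.
have hm1' : 0 < - cross_dir (s + 2 * t * m%:R + 2 * t) x by rewrite oppr_gt0.
have := mulr_gt0 hm1' s2; rewrite mulNr E oppr_gt0 ltNge => /negP; apply.
rewrite addr_ge0//; first by rewrite mulr_ge0// oppr_ge0.
by rewrite -mulrNN mulr_ge0// oppr_ge0.
Qed.

(** An open sector of index [j] meets a closed one of index [k] only if they are
    the same sector, the indices being read modulo [n]. *)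
Lemma sector_unique (k j : int) s x :
  0 <= cross_dir (ang k + s) x -> cross_dir (ang k + s + 2 * t) x <= 0 ->
  0 < cross_dir (ang j + s) x -> cross_dir (ang j + s + 2 * t) x < 0 ->
  exists q : int, j = k + q * n%:Z.
Proof.
move=> h0 h1 h2 h3; have [m [q E]] := ang_modn (j - k).
have [m0|mgt0] := posnP m.
  by exists q; rewrite -(subrK k j) E m0 add0r addrC.
have jE : ang j = ang k + 2 * t * (m : nat)%:R + 2 * pi * q%:~R.
  by rewrite -(subrK k j) E !angD angMn [ang m]/sector_angle; ring.
exfalso; apply: (@sector_disjoint m (ang k + s) x) => //; first by rewrite mgt0 ltn_ord.
  rewrite -(cross_dir_period q) (_ : _ + _ = ang j + s)//; rewrite jE; ring.
rewrite -(cross_dir_period q) (_ : _ + _ = ang j + s + 2 * t)//; rewrite jE; ring.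
Qed.

Lemma dot_dir_diff s x :
  dot_dir (s + t) x - dot_dir (s - t) x = 2 * sin t * cross_dir s x.
Proof. by rewrite /dot_dir /cross_dir !(cosD, sinD, cosN, sinN); ring. Qed.

(** The sector whose bisector has the largest scalar product with [x] contains
    [x]: comparison with the two neighbouring bisectors gives the two signs. *)
Lemma sector_cover s x : exists k : 'I_n,
  0 <= cross_dir (ang k%:Z + s) x /\ cross_dir (ang k%:Z + s + 2 * t) x <= 0.
Proof.
have i0 : 'I_n by exists 0%N; case: n n3.
pose F (i : 'I_n) := dot_dir (ang i%:Z + s + t) x.
have [i _ imax] := @Order.TotalTheory.arg_maxP _ R _ i0 xpredT F isT.
have Fmax (k : int) : dot_dir (ang k + s + t) x <= dot_dir (ang i%:Z + s + t) x.
  have [j [q ->]] := ang_modn k.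
  rewrite angD angMn.
  rewrite (_ : _ + t = ang j + s + t + 2 * pi * q%:~R) ?dot_dir_period; last by ring.
  exact: imax.
exists i; split.
  have := Fmax (i%:Z - 1); rewrite angD (_ : ang (- 1) = - (2 * t)); last first.
    by rewrite /sector_angle mulrN1.
  rewrite (_ : _ + t = ang i + s - t); last by ring.
  by rewrite -subr_ge0 dot_dir_diff pmulr_rge0// mulr_gt0// sin_half_angle_gt0.
have := Fmax (i%:Z + 1); rewrite angD ang1.
rewrite (_ : ang i + 2 * t + s + t = ang i + s + 2 * t + t); last by ring.
rewrite -[in X in _ <= X -> _](addrK (2 * t) (ang i + s)).
rewrite (_ : _ - 2 * t + t = ang i + s + 2 * t - t); last by ring.
by rewrite -subr_le0 dot_dir_diff pmulr_rle0// mulr_gt0// sin_half_angle_gt0.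
Qed.

Lemma sum_sectors (V : zmodType) (G : int -> V) (k : int) :
  (forall j q : int, G (j + q * n%:Z) = G j) ->
  (forall j : int, G j != 0 -> exists q : int, j = k + q * n%:Z) ->
  \sum_(j < n) G j%:Z = G k.
Proof.
move=> Gper Gk; have [j0 [q0 kE]] := ang_modn k.
rewrite kE Gper (bigD1 j0)//= big1 ?addr0// => j jj0.
apply/eqP; apply: contraNT jj0 => /Gk[q]; rewrite kE -addrA -mulrDl => jE.
have hh : ((j%:Z)%Z = j0%:Z %[mod n%:Z])%Z by rewrite jE addrC modzMDl.
move: hh; rewrite !modz_small ?lez_nat ?ltz_nat ?leq0n ?ltn_ord// => -[] /val_inj ->.
exact: eqxx.
Qed.

End Sectors.

(** * Convex hulls and regular polygons *)
Section ConvexHull.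
Context {R : realType}.
Implicit Types (A C : set 'cV[R]_2) (x y : 'cV[R]_2).

Lemma convex_setE C : convex_set C <->
  forall x y (l : R), 0 <= l <= 1 -> C x -> C y -> C (l *: x + (1 - l) *: y).
Proof.
split=> [cC x y l /andP[l0 l1] Cx Cy|cC x y l].
  by have := cC x y (Itv01 l0 l1) (mem_set Cx) (mem_set Cy); rewrite inE.
rewrite !inE => Cx Cy; apply: cC => //; by rewrite ge0/= le1.
Qed.

Lemma convex_hull_conv A x y (l : R) : 0 <= l <= 1 ->
  convex_hull A x -> convex_hull A y -> convex_hull A (l *: x + (1 - l) *: y).
Proof.
move=> l01 hx hy C [cC AC]; move/convex_setE: (cC); apply => //.
  by apply: hx; split.
by apply: hy; split.
Qed.

Lemma convex_hull_conv3 A x y z (a b c : R) : 0 <= a -> 0 <= b -> 0 <= c ->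
  a + b + c = 1 -> convex_hull A x -> convex_hull A y -> convex_hull A z ->
  convex_hull A (a *: x + b *: y + c *: z).
Proof.
move=> a0 b0 c0 abc hx hy hz.
have [ab|ab] := eqVneq (a + b) 0.
  have -> : a = 0 by lra.
  have -> : b = 0 by lra.
  have -> : c = 1 by lra.
  by rewrite !scale0r !add0r scale1r.
have abp : 0 < a + b by rewrite lt0r ab addr_ge0.
have -> : a *: x + b *: y + c *: z =
    (a + b) *: ((a / (a + b)) *: x + (1 - a / (a + b)) *: y) + (1 - (a + b)) *: z.
  rewrite scalerDr !scalerA mulrBr mulr1 mulrC divfK// [a + b - a]addrAC subrr add0r.
  by congr (_ + _ *: _); lra.
apply: convex_hull_conv => //; first lra.
apply: convex_hull_conv => //; apply/andP; split; first by rewrite divr_ge0// ltW.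
by rewrite ler_pdivrMr// mul1r lerDl.
Qed.

Lemma convex_hull_le A (phi : 'cV[R]_2 -> R) (c : R) :
  (forall x y l, phi (l *: x + (1 - l) *: y) = l * phi x + (1 - l) * phi y) ->
  (forall x, A x -> phi x <= c) -> forall x, convex_hull A x -> phi x <= c.
Proof.
move=> aff Ac x hx; apply: (hx [set y | phi y <= c]); split => // .
apply/convex_setE => y z l /andP[l0 l1] /= hy hz; rewrite aff.
have -> : c = l * c + (1 - l) * c by ring.
by rewrite lerD// ler_wpM2l// subr_ge0.
Qed.

End ConvexHull.

Section RegularPolygon.
Context {R : realType} (n : nat).
Hypothesis n3 : (3 <= n)%N.
Implicit Types (x y : 'cV[R]_2) (s : R).
Local Notation t := (@half_angle R n).
Local Notation ang := (@sector_angle R n).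

(** Vertices are indexed by all integers, so that neighbours need no wrap-around
    conventions. *)
Definition polygon (r s : R) : set 'cV[R]_2 :=
  convex_hull [set r *: dir (ang k + s) | k in [set: int]].

Lemma polygon_vertex r s k : polygon r s (r *: dir (ang k + s)).
Proof. by apply: sub_gen_smallest; exists k. Qed.

(** Among the vertices of a regular polygon, the two ends of an edge are the
    furthest in the direction normal to that edge: the difference of the two
    cosines is [2 sin (m t) sin ((m + 1) t)]. *)
Lemma cos_odd_le (m : int) : cos (ang m + t) <= cos t.
Proof.
have [j [q ->]] := ang_modn n3 m.
rewrite angD angMn// addrAC cos_period.
have t0 : 0 < t := half_angle_gt0 n3; have tn : t * n%:R = pi := half_angle_n n3.
rewrite -subr_ge0 (_ : _ - _ = 2 * (sin (t * j%:R) * sin (t * (j%:R + 1)))); last first.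
  set a := t * j%:R; set b := t * (j%:R + 1).
  rewrite (_ : ang j + t = b + a); last by rewrite /sector_angle /a /b -pmulrn; ring.
  rewrite (_ : cos t = cos (b - a)); last by congr cos; rewrite /a /b; ring.
  by rewrite cosB cosD; ring.
have j0 : (0 : R) <= j%:R by [].
have jn : (j%:R : R) + 1 <= n%:R by rewrite natr1 ler_nat.
have h1 : t * (j%:R + 1) <= t * n%:R by rewrite ler_pM2l.
have h2 : 0 <= t * j%:R by rewrite mulr_ge0// ltW.
by rewrite mulr_ge0// mulr_ge0// sin_ge0_pi//; lra.
Qed.

Lemma polygon_le r s k x : 0 <= r -> polygon r s x ->
  dot_dir (ang k + s + t) x <= r * cos t.
Proof.
move=> r0; apply: convex_hull_le => [y z l|_ [j _ <-]].
  by rewrite dot_dirD !dot_dirZ.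
rewrite dot_dir_dir ler_wpM2l//.
rewrite (_ : ang j + s - _ = ang (j - k - 1) + t); first exact: cos_odd_le.
by rewrite /sector_angle !intrD !mulrNz; ring.
Qed.

Lemma sector_coord s x : 0 <= cross_dir s x -> cross_dir (s + 2 * t) x <= 0 ->
  exists p q : R, [/\ 0 <= p, 0 <= q,
    x = p *: dir s + q *: dir (s + 2 * t) &
    dot_dir (s + t) x = (p + q) * cos t].
Proof.
move=> h0 h1; have s2 : 0 < sin (2 * t) := sin_half_angle2_gt0 n3.
have := dir_coord s (s + 2 * t) x; rewrite (_ : s + 2 * t - s = 2 * t); last by ring.
move=> E.
have xE : x = (- cross_dir (s + 2 * t) x / sin (2 * t)) *: dir s +
    (cross_dir s x / sin (2 * t)) *: dir (s + 2 * t).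
  rewrite ![_ / sin (2 * t)]mulrC -!scalerA -scalerDr -E scalerA mulVf ?scale1r//.
  by rewrite gt_eqF.
have p0 : 0 <= - cross_dir (s + 2 * t) x / sin (2 * t).
  by rewrite divr_ge0 ?oppr_ge0// ltW.
have q0 : 0 <= cross_dir s x / sin (2 * t) by rewrite divr_ge0// ltW.
move: p0 q0 xE; set p := _ / _; set q := cross_dir s x / _ => p0 q0 xE.
exists p, q; split => //; rewrite {}[in LHS]xE; clearbody p q.
rewrite dot_dirD !dot_dir_dir [RHS]mulrDl.
by congr (_ * _ + _ * _); [rewrite -cosN|]; congr cos; ring.
Qed.

(** If [- r dir s] is in the sector [k], then the centre is a combination with
    nonnegative coefficients of the first vertex and of the vertices [k] and
    [k + 1]. *)
Lemma polygon0 r s : 0 < r -> polygon r s 0.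
Proof.
move=> r0; have [i [h0 h1]] := sector_cover n3 s (- (r *: dir s)); set k := (i%:Z) in h0 h1.
have [p [q [p0 q0 E _]]] := sector_coord h0 h1.
have D0 : 0 < r + p + q by rewrite ltr_wpDr// ltr_wpDr.
have -> : (0 : 'cV[R]_2) = (r / (r + p + q)) *: (r *: dir (ang 0 + s)) +
    (p / (r + p + q)) *: (r *: dir (ang k + s)) +
    (q / (r + p + q)) *: (r *: dir (ang (k + 1) + s)).
  rewrite angD ang1 (addrAC (ang k)) {1}/sector_angle mulr0 add0r.
  rewrite ![_ / (r + p + q)]mulrC !scalerA -!(mulrC r) -![_ * _^-1]mulrC -?scalerA.
  have : r *: dir s + (p *: dir (ang k + s) + q *: dir (ang k + s + 2 * t)) = 0.
    by rewrite -E subrr.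
  move=> /(congr1 (fun v => ((r + p + q)^-1 * r) *: v)).
  rewrite scaler0 => <-; rewrite !scalerDr !scalerA addrA.
  by congr (_ *: _ + _ *: _ + _ *: _); ring.
have D (c : R) : 0 <= c -> 0 <= c / (r + p + q).
  by move=> c0; rewrite divr_ge0// ltW.
apply: convex_hull_conv3; try exact: polygon_vertex; try by apply: D => //; exact: ltW.
by rewrite -!mulrDl mulfV// gt_eqF.
Qed.

(** Such an [x] is in the triangle spanned by the centre and an edge. *)
Lemma sector_polygon r s (k : int) x : 0 < r ->
  0 <= cross_dir (ang k + s) x -> cross_dir (ang k + s + 2 * t) x <= 0 ->
  dot_dir (ang k + s + t) x <= r * cos t -> polygon r s x.
Proof.
move=> r0 h0 h1; have [p [q [p0 q0 xE ->]]] := sector_coord h0 h1.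
rewrite ler_pM2r ?(cos_half_angle_gt0 n3)// => pq; rewrite xE.
have -> : p *: dir (ang k + s) + q *: dir (ang k + s + 2 * t) =
    (1 - p / r - q / r) *: (0 : 'cV[R]_2) + (p / r) *: (r *: dir (ang k + s)) +
    (q / r) *: (r *: dir (ang (k + 1) + s)).
  rewrite scaler0 add0r !scalerA !divfK ?gt_eqF// angD ang1.
  by congr (_ + _ *: dir _); ring.
apply: convex_hull_conv3; try exact: polygon_vertex; try exact: polygon0.
- by rewrite -addrA -opprD -mulrDl subr_ge0 ler_pdivrMr// mul1r.
- by rewrite divr_ge0// ltW.
- by rewrite divr_ge0// ltW.
- by ring.
Qed.

End RegularPolygon.

(** * Affine and Lipschitz functions of the plane *)
Section AffineFunctions.
Context {R : realType}.
Implicit Types (f g : 'cV[R]_2 -> R) (x y : 'cV[R]_2).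

(** Stated with coefficients, which is the form needed to see that the zero set
    is a line. *)
Definition affine_fun f : Prop :=
  exists a b c : R, forall x, f x = a * x 0 0 + b * x 1 0 + c.

Lemma affine_fun_cst (c : R) : affine_fun (fun=> c).
Proof. by exists 0, 0, c => x; rewrite !mul0r !add0r. Qed.

Lemma affine_dot_dir s : affine_fun (dot_dir s).
Proof. by exists (cos s), (sin s), 0 => x; rewrite /dot_dir; ring. Qed.

Lemma affine_cross_dir s : affine_fun (cross_dir s).
Proof. by exists (- sin s), (cos s), 0 => x; rewrite /cross_dir; ring. Qed.

Lemma affine_funD f g : affine_fun f -> affine_fun g -> affine_fun (fun x => f x + g x).
Proof.
move=> [a [b [c E]]] [a' [b' [c' E']]]; exists (a + a'), (b + b'), (c + c') => x.
by rewrite E E'; ring.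
Qed.

Lemma affine_funM f (r : R) : affine_fun f -> affine_fun (fun x => f x * r).
Proof.
move=> [a [b [c E]]]; exists (a * r), (b * r), (c * r) => x.
by rewrite E; ring.
Qed.

Lemma affine_funN f : affine_fun f -> affine_fun (fun x => - f x).
Proof.
move=> [a [b [c E]]]; exists (- a), (- b), (- c) => x.
by rewrite E; ring.
Qed.

Lemma affine_fun_ae_neq0 f x : affine_fun f -> f x != 0 ->
  {ae leb2 R, forall p, f (pt p) != 0}.
Proof.
move=> [a [b [c E]]] fx.
have abc : [|| a != 0, b != 0 | c != 0].
  apply: contraNT fx; rewrite !negb_or !negbK => /and3P[/eqP a0 /eqP b0 /eqP c0].
  by rewrite E a0 b0 c0 !mul0r !addr0.
exists [set p | a * p.1 + b * p.2 + c = 0]; split.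
- have mf : measurable_fun [set: plane R] (fun p : plane R => a * p.1 + b * p.2 + c).
    by apply: measurable_funD => //; apply: measurable_funD => //; apply: measurable_funM.
  by have := mf measurableT _ (measurable_set1 0); rewrite setTI.
- exact: leb2_null_line.
- move=> p /= /negP; rewrite negbK => /eqP; rewrite E vec2E0 vec2E1//.
Qed.

Definition lipschitz_fun f : Prop := exists L : R, lipschitz_with L f.

Lemma lipschitz_withW (L M : R) f : L <= M -> lipschitz_with L f -> lipschitz_with M f.
Proof. by move=> LM lf x y; apply: le_trans (lf x y) _; rewrite ler_wpM2r. Qed.

Lemma affine_fun_lipschitz f : affine_fun f -> lipschitz_fun f.
Proof.
move=> [a [b [c E]]]; exists (`|a| + `|b|) => x y.
have -> : f x - f y = a * (x - y) 0 0 + b * (x - y) 1 0 by rewrite !E !mxE; ring.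
apply: le_trans (ler_normD _ _) _; rewrite !normrM mulrDl.
by rewrite lerD// ler_wpM2l// coord_le_norm.
Qed.

Lemma lipschitz_funD f g : lipschitz_fun f -> lipschitz_fun g ->
  lipschitz_fun (fun x => f x + g x).
Proof.
move=> [L lf] [M lg]; exists (L + M) => x y.
rewrite opprD addrACA mulrDl; apply: le_trans (ler_normD _ _) _; exact: lerD.
Qed.

Lemma lipschitz_funM f (r : R) : lipschitz_fun f -> lipschitz_fun (fun x => f x * r).
Proof.
move=> [L lf]; exists (L * `|r|) => x y.
by rewrite -mulrBl normrM mulrAC ler_wpM2r.
Qed.

Lemma lipschitz_fun_sum (I : finType) (F : I -> 'cV[R]_2 -> R) :
  (forall i, lipschitz_fun (F i)) -> lipschitz_fun (fun x => \sum_i F i x).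
Proof.
move=> lF; elim: (index_enum I) => [|i s [L IH]].
  by exists 0 => x y; rewrite !big_nil subrr normr0 mul0r.
have [|M H] := @lipschitz_funD (F i) (fun x => \sum_(j <- s) F j x) (lF i); first by exists L.
by exists M => x y; rewrite !big_cons; exact: H.
Qed.

Lemma lipschitz_fun_min f g : lipschitz_fun f -> lipschitz_fun g ->
  lipschitz_fun (fun x => Num.min (f x) (g x)).
Proof.
move=> [L lf] [M lg]; exists (L + M) => x y.
have h1 := lf x y; have h2 := lg x y.
have L0 : 0 <= L * `|x - y| := le_trans (normr_ge0 _) h1.
have M0 : 0 <= M * `|x - y| := le_trans (normr_ge0 _) h2.
rewrite mulrDl; move: h1 h2; rewrite !ler_norml => /andP[h1 h2] /andP[h3 h4].
by case: (leP (f x) (g x)); case: (leP (f y) (g y)) => ? ?; apply/andP; split; lra.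
Qed.

Lemma lipschitz_fun_max f g : lipschitz_fun f -> lipschitz_fun g ->
  lipschitz_fun (fun x => Num.max (f x) (g x)).
Proof.
move=> [L lf] [M lg]; exists (L + M) => x y.
have h1 := lf x y; have h2 := lg x y.
have L0 : 0 <= L * `|x - y| := le_trans (normr_ge0 _) h1.
have M0 : 0 <= M * `|x - y| := le_trans (normr_ge0 _) h2.
rewrite mulrDl; move: h1 h2; rewrite !ler_norml => /andP[h1 h2] /andP[h3 h4].
by case: (leP (f x) (g x)); case: (leP (f y) (g y)) => ? ?; apply/andP; split; lra.
Qed.

Lemma affine_fun_continuous f : affine_fun f -> continuous f.
Proof. by move=> /affine_fun_lipschitz[L]; exact: lipschitz_with_continuous. Qed.

Lemma affine_fun_near_gt0 f x : affine_fun f -> 0 < f x -> \forall y \near x, 0 < f y.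
Proof.
move=> /affine_fun_continuous cf fx.
exact: (@cvgr_gt _ _ _ (nbhs_filter x) _ _ (cf x) _ fx).
Qed.

End AffineFunctions.

(** * The interpolant *)
Section Tents.
Context {R : realType}.
Implicit Types (p q e m : R).

(** The three cases are the three affine pieces of a tent at an outer vertex [E],
    met along a ray from the centre; [x = p E + q I], and [e] is the value at [E]
    of the linear form that is 1 on the inner edge facing [E]. The first change of
    piece is on that edge, the second on the segment from [E] to [I]. *)
Lemma tent_outer_eval p q p' e A : 1 < e -> 0 <= p -> p <= p' -> A = p * e + q - 1 ->
  let h := Num.max 0 (Num.min (A / (e - 1)) (Num.min p p')) in
  [/\ A <= 0 -> h = 0, 0 <= A -> p + q <= 1 -> h = A / (e - 1) &
      1 <= p + q -> h = p].
Proof.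
move=> e1 p0 pp' AE /=; rewrite (min_l pp').
have e0 : 0 < e - 1 by lra.
split => [A0|A0 pq|pq].
- by apply/max_idPl; rewrite ge_min pmulr_lle0 ?invr_gt0// A0.
- rewrite min_l; first by apply/max_idPr; rewrite divr_ge0// ltW.
  by rewrite ler_pdivrMr// AE; lra.
- rewrite minC min_l; first exact/max_idPr.
  by rewrite ler_pdivlMr// AE; lra.
Qed.

(** The pieces of a tent at an inner vertex [I] in the same coordinates; [m] is
    the value at [I] of the linear form that is 1 on the outer edge. The changes
    of piece are on the segment from [E] to [I] and on the outer edge. *)
Lemma tent_inner_eval p q q' m B B' : m < 1 -> 0 <= q -> q <= q' -> B <= B' ->
  B = p + q - 1 ->
  let h := Num.max 0 (Num.min (Num.min B B' / (1 - m)) (Num.min q q')) in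
  [/\ p + q <= 1 -> h = 0, 1 <= p + q -> p + m * q <= 1 -> h = B / (1 - m) &
      1 <= p + m * q -> h = q].
Proof.
move=> m1 q0 qq' BB' BE /=; rewrite (min_l qq') (min_l BB').
have m0 : 0 < 1 - m by lra.
split => [pq|pq pmq|pmq].
- by apply/max_idPl; rewrite ge_min pmulr_lle0 ?invr_gt0// BE; apply/orP; left; lra.
- rewrite min_l; first by apply/max_idPr; rewrite divr_ge0 ?BE//; lra.
  by rewrite ler_pdivrMr// BE; lra.
- rewrite minC min_l; first exact/max_idPr.
  by rewrite ler_pdivlMr// BE; lra.
Qed.

End Tents.

Section Interpolant.
Context {R : realType} (n : nat) (b rE rI : R).
Local Notation t := (@half_angle R n).
Local Notation ang := (@sector_angle R n).
Hypothesis n3 : (3 <= n)%N.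
Hypothesis b_gt0 : 0 < b.
Hypothesis b_lt : b < 2 * t.
Hypothesis rI0 : 0 < rI.
Hypothesis rE0 : 0 < rE.
Local Notation b' := (2 * t - b).
Local Notation d := (t - b).
(* The vertices [E] are outside the inner polygon, and the vertices [I] are
   inside the outer one. *)
Hypothesis outside : rI * cos t < rE * cos d.
Hypothesis inside : rI * cos d < rE * cos t.
Implicit Types (x y : 'cV[R]_2) (s : R).

Definition vertexE s : 'cV[R]_2 := rE *: dir s.
Definition vertexI s : 'cV[R]_2 := rI *: dir (s + b).

(** Coordinates on the vertices near the direction [s] of an outer vertex.
    [pR] is the coordinate on [vertexE s] along with [vertexI s], and [pL] the one
    along with [vertexI (s - 2 * t)]; [qL] is the coordinate on [vertexI s] along
    with [vertexE s], and [qR] the one along with [vertexE (s + 2 * t)]. *)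
Definition pR s x := - cross_dir (s + b) x / (rE * sin b).
Definition pL s x := cross_dir (s - b') x / (rE * sin b').
Definition qL s x := cross_dir s x / (rI * sin b).
Definition qR s x := - cross_dir (s + 2 * t) x / (rI * sin b').
(** [lineI] vanishes on the inner edge that faces [vertexE s]; [gaugeE] is 1 on
    the outer edge from [vertexE s]; [lineL] and [lineR] vanish on the segments
    from [vertexI s] to [vertexE s] and to [vertexE (s + 2 * t)]. All are negative,
    or less than 1, on the side of the centre. *)
Definition lineI s x := dot_dir (s - d) x / (rI * cos t) - 1.
Definition gaugeE s x := dot_dir (s + t) x / (rE * cos t).
Definition lineL s x := pR s x + qL s x - 1.
Definition lineR s x := pL (s + 2 * t) x + qR s x - 1.
Definition eI := rE * cos d / (rI * cos t).
Definition mE := rI * cos d / (rE * cos t).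

(** It grows from 0 on the inner edge facing [vertexE s] to 1 at [vertexE s].
    Beyond the segments from [vertexE s] to the two nearest inner vertices it is
    the coordinate of [x] on [vertexE s], and it vanishes on the directions of
    these inner vertices. *)
Definition tentE s x :=
  Num.max 0 (Num.min (lineI s x / (eI - 1)) (Num.min (pR s x) (pL s x))).
(** It grows from 0, on the segments from [vertexI s] to the two nearest outer
    vertices, to the coordinate of [x] on [vertexI s], which it equals from the
    outer edge on. *)
Definition tentI s x :=
  Num.max 0 (Num.min (Num.min (lineL s x) (lineR s x) / (1 - mE))
                     (Num.min (qL s x) (qR s x))).

Definition interpolant x : 'cV[R]_2 :=
  \sum_(k < n) tentE (ang k) x *: vertexE (ang k) +
  \sum_(k < n) tentI (ang k) x *: vertexI (ang k).

Lemma sinb_gt0 : 0 < sin b.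
Proof.
have h1 := @half_angle_le R n n3; have h2 := @half_angle_gt0 R n n3.
by apply: sin_gt0_pi; move: b_gt0 b_lt h1 h2; lra.
Qed.

Lemma sinb'_gt0 : 0 < sin b'.
Proof.
have h1 := @half_angle_le R n n3; have h2 := @half_angle_gt0 R n n3.
by apply: sin_gt0_pi; move: b_gt0 b_lt h1 h2; lra.
Qed.

Let sb := sinb_gt0.
Let sb' := sinb'_gt0.
Let ct : 0 < cos t := cos_half_angle_gt0 n3.
Let st : 0 < sin t := sin_half_angle_gt0 n3.
Let s2t : 0 < sin (2 * t) := sin_half_angle2_gt0 n3.
Let sbN : sin b != 0. Proof. by rewrite gt_eqF. Qed.
Let sb'N : sin b' != 0. Proof. by rewrite gt_eqF. Qed.
Let ctN : cos t != 0. Proof. by rewrite gt_eqF. Qed.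
Let rIN : rI != 0. Proof. by rewrite gt_eqF. Qed.
Let rEN : rE != 0. Proof. by rewrite gt_eqF. Qed.

Lemma eI_gt1 : 1 < eI.
Proof. by rewrite /eI ltr_pdivlMr ?mul1r// mulr_gt0. Qed.

Lemma mE_lt1 : mE < 1.
Proof. by rewrite /mE ltr_pdivrMr ?mul1r// mulr_gt0. Qed.

Lemma sin_sumE : sin b + sin b' = 2 * sin t * cos d.
Proof.
rewrite (_ : sin b = sin (t - d)); last by congr sin; ring.
rewrite (_ : sin b' = sin (t + d)); last by congr sin; ring.
by rewrite (sinB t d) (sinD t d); ring.
Qed.

Lemma sin_half_angle2E : sin (2 * t) = 2 * sin t * cos t.
Proof. by rewrite (_ : 2 * t = t + t) ?sinD; ring. Qed.

(** The sum of the areas of the triangles [0 E I] and [0 I E'] is at most that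
    of [0 E E']: the segments [E I] and [I E'] make a reflex corner at [I],
    seen from the centre. *)
Lemma sin_sum_le : rI * (sin b + sin b') <= rE * sin (2 * t).
Proof.
rewrite sin_sumE sin_half_angle2E !(mulrCA _ (2 * sin t)).
by rewrite ler_pM2l ?mulr_gt0// ltW.
Qed.

(** In the half-sector between [vertexE s] and [vertexI s], the tents are given by
    the coordinates in that frame: the other arguments of the minima are larger,
    by the three-term relations and [sin_sum_le]. *)
Lemma frameL s x : 0 <= cross_dir s x -> cross_dir (s + b) x <= 0 ->
  [/\ 0 <= pR s x, 0 <= qL s x, pR s x <= pL s x & qL s x <= qR s x] /\
  [/\ lineL s x <= lineR s x, lineI s x = pR s x * eI + qL s x - 1,
    gaugeE s x = pR s x + mE * qL s x &
    x = pR s x *: vertexE s + qL s x *: vertexI s].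
Proof.
move=> h0 h1.
have p0 : 0 <= pR s x by rewrite divr_ge0 ?oppr_ge0// mulr_ge0// ltW.
have q0 : 0 <= qL s x by rewrite divr_ge0// mulr_ge0// ltW.
have X1 : cross_dir s x = qL s x * (rI * sin b) by rewrite divfK// mulf_neq0.
have X2 : cross_dir (s + b) x = - (pR s x * (rE * sin b)).
  by rewrite divfK ?opprK// mulf_neq0.
have X3 : cross_dir (s - b') x = qL s x * rI * sin (2 * t) + pR s x * rE * sin b'.
  apply: (mulIf sbN); have := cross_dir_three s (s + b) (s - b') x.
  rewrite (_ : s + b - s = b); last by ring.
  rewrite (_ : s + b - _ = 2 * t); last by ring.
  rewrite (_ : s - b' - s = - b'); last by ring.
  by move=> ->; rewrite sinN X1 X2; ring.
have X4 : cross_dir (s + 2 * t) x = - (qL s x * rI * sin b') - pR s x * rE * sin (2 * t).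
  apply: (mulIf sbN); have := cross_dir_three s (s + b) (s + 2 * t) x.
  rewrite (_ : s + b - s = b); last by ring.
  rewrite (_ : s + b - _ = - b'); last by ring.
  rewrite (_ : s + 2 * t - s = 2 * t); last by ring.
  by move=> ->; rewrite sinN X1 X2; ring.
have X5 : dot_dir (s - d) x = qL s x * rI * cos t + pR s x * rE * cos d.
  apply: (mulIf sbN); have := dot_dir_three s (s + b) (s - d) x.
  rewrite (_ : s + b - s = b); last by ring.
  rewrite (_ : s + b - _ = t); last by ring.
  rewrite (_ : s - (s - d) = d); last by ring.
  by move=> ->; rewrite X1 X2; ring.
have X6 : dot_dir (s + t) x = qL s x * rI * cos d + pR s x * rE * cos t.
  apply: (mulIf sbN); have := dot_dir_three s (s + b) (s + t) x.
  rewrite (_ : s + b - s = b); last by ring.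
  rewrite (_ : s + b - _ = - d); last by ring.
  rewrite (_ : s - (s + t) = - t); last by ring.
  by move=> ->; rewrite !cosN X1 X2; ring.
have pLE : pL s x = pR s x + qL s x * (rI * sin (2 * t) / (rE * sin b')).
  by rewrite {1}/pL X3; field; rewrite rEN sb'N.
have qRE : qR s x = qL s x + pR s x * (rE * sin (2 * t) / (rI * sin b')).
  by rewrite {1}/qR X4; field; rewrite rIN sb'N.
have pLE' : pL (s + 2 * t) x = - (pR s x * (sin b / sin b')).
  rewrite {1}/pL (_ : s + 2 * t - b' = s + b); last by ring.
  by rewrite X2; field; rewrite rEN sb'N.
split; split => //.
- by rewrite pLE lerDl mulr_ge0// divr_ge0// mulr_ge0// ltW.
- by rewrite qRE lerDl mulr_ge0// divr_ge0// mulr_ge0// ltW.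
- rewrite /lineL /lineR -subr_ge0.
  have -> : pL (s + 2 * t) x + qR s x - 1 - (pR s x + qL s x - 1) =
     pR s x * ((rE * sin (2 * t) - rI * (sin b + sin b')) / (rI * sin b')).
    by rewrite pLE' qRE; field; rewrite rIN sb'N.
  by rewrite mulr_ge0// divr_ge0 ?subr_ge0 ?sin_sum_le// mulr_ge0// ltW.
- by rewrite /lineI X5 /eI; field; rewrite rIN ctN.
- by rewrite /gaugeE X6 /mE; field; rewrite rEN ctN.
- apply: (scalerI sbN); have := dir_coord s (s + b) x.
  rewrite (_ : s + b - s = b); last by ring.
  move=> ->; rewrite X1 X2 /vertexE /vertexI scalerDr !scalerA opprK.
  by congr (_ *: _ + _ *: _); ring.
Qed.

(** The mirror image of [frameL], between [vertexI s] and [vertexE (s + 2 * t)]. *)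
Lemma frameR s x : 0 <= cross_dir (s + b) x -> cross_dir (s + 2 * t) x <= 0 ->
  [/\ 0 <= pL (s + 2 * t) x, 0 <= qR s x, pL (s + 2 * t) x <= pR (s + 2 * t) x &
      qR s x <= qL s x] /\
  [/\ lineR s x <= lineL s x,
    lineI (s + 2 * t) x = pL (s + 2 * t) x * eI + qR s x - 1,
    gaugeE s x = pL (s + 2 * t) x + mE * qR s x &
    x = pL (s + 2 * t) x *: vertexE (s + 2 * t) + qR s x *: vertexI s].
Proof.
move=> h0 h1; set p := pL (s + 2 * t) x; set q := qR s x.
have shift : s + 2 * t - b' = s + b by ring.
have p0 : 0 <= p by rewrite /p /pL shift divr_ge0// mulr_ge0// ltW.
have q0 : 0 <= q by rewrite divr_ge0 ?oppr_ge0// mulr_ge0// ltW.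
have X1 : cross_dir (s + 2 * t) x = - (q * (rI * sin b')).
  by rewrite divfK ?opprK// mulf_neq0.
have X2 : cross_dir (s + b) x = p * (rE * sin b').
  by rewrite /p /pL shift divfK// mulf_neq0.
have bE : s + 2 * t - (s + b) = b' by ring.
have X3 : cross_dir (s + 2 * t + b) x = - (q * rI * sin (2 * t)) - p * rE * sin b.
  apply: (mulIf sb'N); have := cross_dir_three (s + b) (s + 2 * t) (s + 2 * t + b) x.
  rewrite bE (_ : s + 2 * t - _ = - b); last by ring.
  rewrite (_ : s + 2 * t + b - _ = 2 * t); last by ring.
  by move=> ->; rewrite sinN X1 X2; ring.
have X4 : cross_dir s x = q * rI * sin b + p * rE * sin (2 * t).
  apply: (mulIf sb'N); have := cross_dir_three (s + b) (s + 2 * t) s x.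
  rewrite bE (_ : s + 2 * t - _ = 2 * t); last by ring.
  rewrite (_ : s - (s + b) = - b); last by ring.
  by move=> ->; rewrite sinN X1 X2; ring.
have X5 : dot_dir (s + 2 * t - d) x = q * rI * cos t + p * rE * cos d.
  apply: (mulIf sb'N); have := dot_dir_three (s + b) (s + 2 * t) (s + 2 * t - d) x.
  rewrite bE (_ : s + 2 * t - (s + 2 * t - d) = d); last by ring.
  rewrite (_ : s + b - _ = - t); last by ring.
  by move=> ->; rewrite !cosN X1 X2; ring.
have X6 : dot_dir (s + t) x = q * rI * cos d + p * rE * cos t.
  apply: (mulIf sb'N); have := dot_dir_three (s + b) (s + 2 * t) (s + t) x.
  rewrite bE (_ : s + 2 * t - _ = t); last by ring.
  rewrite (_ : s + b - _ = - d); last by ring.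
  by move=> ->; rewrite !cosN X1 X2; ring.
have pE : pR (s + 2 * t) x = p + q * (rI * sin (2 * t) / (rE * sin b)).
  by rewrite {1}/pR X3; field; rewrite rEN sbN.
have qE : qL s x = q + p * (rE * sin (2 * t) / (rI * sin b)).
  by rewrite {1}/qL X4; field; rewrite rIN sbN.
have pE' : pR s x = - (p * (sin b' / sin b)).
  by rewrite {1}/pR X2; field; rewrite rEN sbN.
split; split => //.
- by rewrite pE lerDl mulr_ge0// divr_ge0// mulr_ge0// ltW.
- by rewrite qE lerDl mulr_ge0// divr_ge0// mulr_ge0// ltW.
- rewrite /lineL /lineR -/p -/q -subr_ge0.
  have -> : pR s x + qL s x - 1 - (p + q - 1) =
     p * ((rE * sin (2 * t) - rI * (sin b + sin b')) / (rI * sin b)).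
    by rewrite pE' qE; field; rewrite rIN sbN.
  by rewrite mulr_ge0// divr_ge0 ?subr_ge0 ?sin_sum_le// mulr_ge0// ltW.
- by rewrite /lineI X5 /eI; field; rewrite rIN ctN.
- by rewrite /gaugeE X6 /mE; field; rewrite rEN ctN.
- apply: (scalerI sb'N); have := dir_coord (s + b) (s + 2 * t) x.
  rewrite bE => ->; rewrite X1 X2 /vertexE /vertexI scalerDr !scalerA opprK addrC.
  by congr (_ *: _ + _ *: _); ring.
Qed.

Lemma tentE_period s (q : int) x : tentE (s + 2 * pi * q%:~R) x = tentE s x.
Proof.
rewrite /tentE /lineI /pR /pL.
rewrite (_ : s + _ - d = s - d + 2 * pi * q%:~R); last by ring.
rewrite (_ : s + _ + b = s + b + 2 * pi * q%:~R); last by ring.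
rewrite (_ : s + _ - b' = s - b' + 2 * pi * q%:~R); last by ring.
by rewrite !dot_dir_period !cross_dir_period.
Qed.

Lemma tentI_period s (q : int) x : tentI (s + 2 * pi * q%:~R) x = tentI s x.
Proof.
rewrite /tentI /lineL /lineR /pR /pL /qL /qR.
rewrite (_ : s + _ + b = s + b + 2 * pi * q%:~R); last by ring.
rewrite (_ : s + _ + 2 * t = s + 2 * t + 2 * pi * q%:~R); last by ring.
rewrite (_ : s + 2 * t + _ - b' = s + 2 * t - b' + 2 * pi * q%:~R); last by ring.
by rewrite !cross_dir_period.
Qed.

Lemma max0_min_neq0 (a c e : R) : Num.max 0 (Num.min a (Num.min c e)) != 0 ->
  0 < c /\ 0 < e.
Proof.
move=> h; suff : 0 < Num.min a (Num.min c e) by rewrite !lt_min => /and3P[].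
by rewrite ltNge; apply: contra h => h; apply/eqP/max_idPl.
Qed.

(** A nonzero [tentE] puts [x] in the open sector around its vertex, since the two
    coordinates in its definition are then positive. *)
Lemma sum_tentE (k : int) x : 0 <= cross_dir (ang k - b') x ->
  cross_dir (ang k + b) x <= 0 ->
  \sum_(j < n) tentE (ang j%:Z) x *: vertexE (ang j%:Z) = tentE (ang k) x *: vertexE (ang k).
Proof.
move=> h0 h1; apply: (sum_sectors n3 (G := fun j => tentE (ang j) x *: vertexE (ang j))).
  by move=> j q; rewrite angD angMn// tentE_period /vertexE dir_period.
move=> j; rewrite scaler_eq0 negb_or => /andP[/max0_min_neq0[jR jL] _].
apply: (sector_unique n3 (s := - b') (x := x)) => //.
- by rewrite (_ : _ + 2 * t = ang k + b)//; ring.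
- by move: jL; rewrite /pL pmulr_lgt0// invr_gt0 mulr_gt0.
- rewrite (_ : _ + 2 * t = ang j + b); last by ring.
  by move: jR; rewrite /pR pmulr_lgt0 ?invr_gt0 ?mulr_gt0// oppr_gt0.
Qed.

Lemma sum_tentI (k : int) x : 0 <= cross_dir (ang k) x ->
  cross_dir (ang k + 2 * t) x <= 0 ->
  \sum_(j < n) tentI (ang j%:Z) x *: vertexI (ang j%:Z) = tentI (ang k) x *: vertexI (ang k).
Proof.
move=> h0 h1; apply: (sum_sectors n3 (G := fun j => tentI (ang j) x *: vertexI (ang j))).
  move=> j q; rewrite angD angMn// tentI_period /vertexI.
  by rewrite (_ : _ + b = ang j + b + 2 * pi * q%:~R) ?dir_period//; ring.
move=> j; rewrite scaler_eq0 negb_or => /andP[/max0_min_neq0[jL jR] _].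
apply: (sector_unique n3 (s := 0) (x := x)); rewrite ?addr0//.
- by move: jL; rewrite /qL pmulr_lgt0// invr_gt0 mulr_gt0.
- by move: jR; rewrite /qR pmulr_lgt0 ?invr_gt0 ?mulr_gt0// oppr_gt0.
Qed.

(** The four values, from the centre outwards: inner polygon, triangle at the outer
    vertex, triangle along the outer edge, exterior. *)
Lemma interpolantL (k : int) x : 0 <= cross_dir (ang k) x ->
  cross_dir (ang k + b) x <= 0 ->
  [/\ lineI (ang k) x <= 0 -> interpolant x = 0,
      0 <= lineI (ang k) x -> lineL (ang k) x <= 0 ->
        interpolant x = (lineI (ang k) x / (eI - 1)) *: vertexE (ang k),
      0 <= lineL (ang k) x -> gaugeE (ang k) x <= 1 ->
        interpolant x = x - ((1 - gaugeE (ang k) x) / (1 - mE)) *: vertexI (ang k) &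
      1 <= gaugeE (ang k) x -> interpolant x = x].
Proof.
move=> h0 h1; have e1 := eI_gt1; have m1 := mE_lt1.
have [[p0 q0 pp' qq'] [BB' AE CE xE]] := frameL h0 h1.
have -> : interpolant x =
    tentE (ang k) x *: vertexE (ang k) + tentI (ang k) x *: vertexI (ang k).
  congr (_ + _).
    apply: sum_tentE => //; move: (le_trans p0 pp').
    by rewrite /pL pmulr_lge0// invr_gt0 mulr_gt0.
  apply: sum_tentI => //; move: (le_trans q0 qq').
  by rewrite /qR pmulr_lge0 ?invr_gt0 ?mulr_gt0// oppr_ge0.
have [] := tent_outer_eval e1 p0 pp' AE; rewrite -/(tentE _ _).
have [] := tent_inner_eval m1 q0 qq' BB' erefl; rewrite -/(tentI _ _).
rewrite CE /lineL; set p := pR _ x in p0 AE CE xE *; set q := qL _ x in q0 AE CE xE *.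
move=> I1 I2 I3 O1 O2 O3.
have pe : p <= p * eI by rewrite ler_peMr// ltW.
have mq : mE * q <= q by rewrite ler_piMl// ltW.
split=> [A0|A0 B0|B0 C1|C1].
- have -> : tentI (ang k) x = 0 by apply: I1; lra.
  by rewrite O1// !scale0r addr0.
- have -> : tentI (ang k) x = 0 by apply: I1; lra.
  by rewrite O2 ?scale0r ?addr0//; lra.
- have -> : tentE (ang k) x = p by apply: O3; lra.
  have -> : tentI (ang k) x = (p + q - 1) / (1 - mE) by apply: I2 => //; lra.
  rewrite {1}xE -[RHS]addrA -scalerBl; congr (_ + _ *: _).
  by field; rewrite gt_eqF ?subr_gt0.
- have -> : tentE (ang k) x = p by apply: O3; lra.
  by rewrite I3// -xE.
Qed.

Lemma interpolantR (k : int) x (s := ang k + 2 * t) : 0 <= cross_dir (ang k + b) x ->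
  cross_dir (ang k + 2 * t) x <= 0 ->
  [/\ lineI s x <= 0 -> interpolant x = 0,
      0 <= lineI s x -> lineR (ang k) x <= 0 ->
        interpolant x = (lineI s x / (eI - 1)) *: vertexE s,
      0 <= lineR (ang k) x -> gaugeE (ang k) x <= 1 ->
        interpolant x = x - ((1 - gaugeE (ang k) x) / (1 - mE)) *: vertexI (ang k) &
      1 <= gaugeE (ang k) x -> interpolant x = x].
Proof.
move=> h0 h1; have e1 := eI_gt1; have m1 := mE_lt1.
have [[p0 q0 pp' qq'] [BB' AE CE xE]] := frameR h0 h1.
have sE : s = ang (k + 1) by rewrite /s angD ang1.
have -> : interpolant x = tentE s x *: vertexE s + tentI (ang k) x *: vertexI (ang k).
  rewrite sE; congr (_ + _).
    apply: sum_tentE; rewrite -sE.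
      by rewrite (_ : _ - b' = ang k + b)// /s; ring.
    move: (le_trans p0 pp'); rewrite -/s.
    by rewrite /pR pmulr_lge0 ?invr_gt0 ?mulr_gt0// oppr_ge0.
  apply: sum_tentI => //; move: (le_trans q0 qq').
  by rewrite /qL pmulr_lge0// invr_gt0 mulr_gt0.
have [] := tent_outer_eval e1 p0 pp' AE; rewrite [Num.min (pL _ _) _]minC -/(tentE _ _).
have [] := tent_inner_eval m1 q0 qq' BB' erefl.
rewrite [Num.min (qR _ _) _]minC [Num.min (lineR _ _) _]minC -/(tentI _ _).
rewrite -/s in p0 AE CE xE *.
rewrite CE /lineR -/s; set p := pL _ x in p0 AE CE xE *; set q := qR _ x in q0 AE CE xE *.
move=> I1 I2 I3 O1 O2 O3.
have pe : p <= p * eI by rewrite ler_peMr// ltW.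
have mq : mE * q <= q by rewrite ler_piMl// ltW.
split=> [A0|A0 B0|B0 C1|C1].
- have -> : tentI (ang k) x = 0 by apply: I1; lra.
  by rewrite O1// !scale0r addr0.
- have -> : tentI (ang k) x = 0 by apply: I1; lra.
  by rewrite O2 ?scale0r ?addr0//; lra.
- have -> : tentE s x = p by apply: O3; lra.
  have -> : tentI (ang k) x = (p + q - 1) / (1 - mE) by apply: I2 => //; lra.
  rewrite {1}xE -[RHS]addrA -scalerBl; congr (_ + _ *: _).
  by field; rewrite gt_eqF ?subr_gt0.
- have -> : tentE s x = p by apply: O3; lra.
  by rewrite I3// -xE.
Qed.

Lemma affine_pR s : affine_fun (pR s).
Proof. by apply: affine_funM; apply: affine_funN; exact: affine_cross_dir. Qed.
Lemma affine_pL s : affine_fun (pL s).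
Proof. by apply: affine_funM; exact: affine_cross_dir. Qed.
Lemma affine_qL s : affine_fun (qL s).
Proof. by apply: affine_funM; exact: affine_cross_dir. Qed.
Lemma affine_qR s : affine_fun (qR s).
Proof. by apply: affine_funM; apply: affine_funN; exact: affine_cross_dir. Qed.
Lemma affine_lineI s : affine_fun (lineI s).
Proof.
by apply: affine_funD; [apply: affine_funM; exact: affine_dot_dir|exact: affine_fun_cst].
Qed.
Lemma affine_gaugeE s : affine_fun (gaugeE s).
Proof. by apply: affine_funM; exact: affine_dot_dir. Qed.
Lemma affine_lineL s : affine_fun (lineL s).
Proof.
apply: affine_funD; last exact: affine_fun_cst.
by apply: affine_funD; [exact: affine_pR|exact: affine_qL].
Qed.
Lemma affine_lineR s : affine_fun (lineR s).
Proof.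
apply: affine_funD; last exact: affine_fun_cst.
by apply: affine_funD; [exact: affine_pL|exact: affine_qR].
Qed.

Lemma lipschitz_tentE s : lipschitz_fun (tentE s).
Proof.
apply: lipschitz_fun_max; first exact/affine_fun_lipschitz/affine_fun_cst.
apply: lipschitz_fun_min.
  by apply: lipschitz_funM; exact/affine_fun_lipschitz/affine_lineI.
by apply: lipschitz_fun_min; apply: affine_fun_lipschitz;
  [exact: affine_pR|exact: affine_pL].
Qed.

Lemma lipschitz_tentI s : lipschitz_fun (tentI s).
Proof.
apply: lipschitz_fun_max; first exact/affine_fun_lipschitz/affine_fun_cst.
apply: lipschitz_fun_min; last first.
  by apply: lipschitz_fun_min; apply: affine_fun_lipschitz;
    [exact: affine_qL|exact: affine_qR].
apply: lipschitz_funM.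
by apply: lipschitz_fun_min; apply: affine_fun_lipschitz;
  [exact: affine_lineL|exact: affine_lineR].
Qed.

Lemma lipschitz_interpolant i : lipschitz_fun (fun x => interpolant x i 0).
Proof.
have E : (fun x => interpolant x i 0) = (fun x =>
    \sum_(k < n) tentE (ang k) x * vertexE (ang k) i 0 +
    \sum_(k < n) tentI (ang k) x * vertexI (ang k) i 0).
  apply/funext => x; rewrite !mxE !summxE.
  by congr (_ + _); apply: eq_bigr => k _; rewrite [LHS]mxE.
rewrite E; apply: lipschitz_funD; apply: lipschitz_fun_sum => k;
  apply: lipschitz_funM; [exact: lipschitz_tentE|exact: lipschitz_tentI].
Qed.

(** The linear parts of the second and third values in [interpolantL]. *)
Definition grad_outer s : 'M[R]_2 :=
  (rI * cos t * (eI - 1))^-1 *: outer (vertexE s) (dir (s - d)).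
Definition grad_edge s : 'M[R]_2 :=
  1%:M + (rE * cos t * (1 - mE))^-1 *: outer (vertexI s) (dir (s + t)).

Lemma grad_outer_affine s x :
  (lineI s x / (eI - 1)) *: vertexE s = grad_outer s *m x + - ((eI - 1)^-1 *: vertexE s).
Proof.
rewrite /grad_outer -scalemxAl outer_dir scalerA -scalerBl; congr (_ *: _).
have e1 : eI - 1 != 0 by rewrite gt_eqF// subr_gt0 eI_gt1.
by rewrite /lineI; field; rewrite rIN ctN e1.
Qed.

Lemma grad_edge_affine s x :
  x - ((1 - gaugeE s x) / (1 - mE)) *: vertexI s =
  grad_edge s *m x + - ((1 - mE)^-1 *: vertexI s).
Proof.
rewrite /grad_edge mulmxDl mul1mx -scalemxAl outer_dir scalerA -addrA -scalerBl -scaleNr.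
congr (_ + _ *: _).
have m1 : 1 - mE != 0 by rewrite gt_eqF// subr_gt0 mE_lt1.
by rewrite /gaugeE; field; rewrite rEN ctN m1.
Qed.

(** The lines to avoid are those that bound the half-sectors and those that
    separate the four values of the interpolant. *)
Definition generic_point x := forall k : 'I_n,
  let s := ang k%:Z in
  [/\ cross_dir s x != 0, cross_dir (s + b) x != 0, cross_dir (s + 2 * t) x != 0
    & gaugeE s x - 1 != 0] /\
  [/\ lineI s x != 0, lineI (s + 2 * t) x != 0, lineL s x != 0 & lineR s x != 0].

Lemma cross_dir_nonzero s : exists x, cross_dir s x != 0.
Proof.
exists (dir (s + pi / 2)); rewrite -[dir _]scale1r cross_dir_dir mul1r.
by rewrite addrAC subrr add0r sin_pihalf oner_neq0.
Qed.

Lemma affine_fun_ae_origin (f : 'cV[R]_2 -> R) : affine_fun f -> f 0 = -1 ->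
  {ae leb2 R, forall p, f (pt p) != 0}.
Proof.
move=> af f0; apply: (affine_fun_ae_neq0 (x := 0)) => //.
by rewrite f0 oppr_eq0 oner_neq0.
Qed.

Lemma ae_generic : {ae leb2 R, forall p, generic_point (pt p)}.
Proof.
have C s : {ae leb2 R, forall p, cross_dir s (pt p) != 0}.
  have [x xs] := cross_dir_nonzero s.
  exact: affine_fun_ae_neq0 (affine_cross_dir s) xs.
have D0 s : dot_dir s (0 : 'cV[R]_2) = 0 by rewrite /dot_dir !mxE !mul0r addr0.
have C0 s : cross_dir s (0 : 'cV[R]_2) = 0 by rewrite /cross_dir !mxE !mul0r subr0.
have LI s : {ae leb2 R, forall p, lineI s (pt p) != 0}.
  apply: affine_fun_ae_origin; first exact: affine_lineI.
  by rewrite /lineI D0 mul0r add0r.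
have LL s : {ae leb2 R, forall p, lineL s (pt p) != 0}.
  apply: affine_fun_ae_origin; first exact: affine_lineL.
  by rewrite /lineL /pR /qL !C0 oppr0 !mul0r !add0r.
have LR s : {ae leb2 R, forall p, lineR s (pt p) != 0}.
  apply: affine_fun_ae_origin; first exact: affine_lineR.
  by rewrite /lineR /pL /qR !C0 oppr0 !mul0r !add0r.
have G s : {ae leb2 R, forall p, gaugeE s (pt p) - 1 != 0}.
  apply: (@affine_fun_ae_origin (fun x => gaugeE s x - 1)).
    by apply: affine_funD; [exact: affine_gaugeE|exact: affine_fun_cst].
  by rewrite /gaugeE D0 mul0r add0r.
apply: filter_forall => k; near=> p.
split; split; near: p; by [exact: C|exact: G|exact: LI|exact: LL|exact: LR].
Unshelve. all: by end_near. Qed.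

Lemma near_gt0_2 x (f g : 'cV[R]_2 -> R) (P : 'cV[R]_2 -> Prop) :
  affine_fun f -> affine_fun g -> 0 < f x -> 0 < g x ->
  (forall y, 0 < f y -> 0 < g y -> P y) -> \forall y \near x, P y.
Proof.
move=> af ag fx gx fgP.
exact: (@filterS2 _ _ (nbhs_filter x) _ _ _ fgP (affine_fun_near_gt0 af fx)
  (affine_fun_near_gt0 ag gx)).
Qed.

Lemma near_gt0_4 x (f g h k : 'cV[R]_2 -> R) (P : 'cV[R]_2 -> Prop) :
  affine_fun f -> affine_fun g -> affine_fun h -> affine_fun k ->
  0 < f x -> 0 < g x -> 0 < h x -> 0 < k x ->
  (forall y, 0 < f y -> 0 < g y -> 0 < h y -> 0 < k y -> P y) ->
  \forall y \near x, P y.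
Proof.
move=> af ag ah ak fx gx hx kx fghkP.
have := near_gt0_2 af ag fx gx (fun y fy gy => conj fy gy).
have := near_gt0_2 ah ak hx kx (fun y fy gy => conj fy gy).
by apply: (@filterS2 _ _ (nbhs_filter x)) => y [? ?] [? ?]; exact: fghkP.
Qed.

Let affN s : affine_fun (fun x => - cross_dir s x).
Proof. exact/affine_funN/affine_cross_dir. Qed.
Let affG s : affine_fun (fun x => 1 - gaugeE s x).
Proof.
by apply: affine_funD; [exact: affine_fun_cst|exact/affine_funN/affine_gaugeE].
Qed.
Let affG' s : affine_fun (fun x => gaugeE s x - 1).
Proof.
by apply: affine_funD; [exact: affine_gaugeE|exact: affine_fun_cst].
Qed.

Lemma gaugeE_polygon s x (k : int) : s = ang k -> polygon n rE 0 x -> gaugeE s x <= 1.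
Proof.
move=> -> /(polygon_le n3 k (ltW rE0)); rewrite addr0 /gaugeE => h.
by rewrite ler_pdivrMr ?mulr_gt0// mul1r.
Qed.

Lemma lineI_polygon s x (k : int) : s = ang k -> 0 <= cross_dir (s - b') x ->
  cross_dir (s + b) x <= 0 -> lineI s x <= 0 -> polygon n rI b x.
Proof.
move=> -> h0 h1; rewrite /lineI subr_le0 ler_pdivrMr ?mulr_gt0// mul1r => h.
have E : ang (k - 1) = ang k - 2 * t.
  by rewrite angD (_ : ang (-1) = - (2 * t))// /sector_angle mulrN1.
apply: (sector_polygon n3 (k := k - 1)) => //; rewrite E.
- by rewrite (_ : _ + b = ang k - b')//; ring.
- by rewrite (_ : _ + 2 * t = ang k + b)//; ring.
- by rewrite (_ : _ + t = ang k - d)//; ring.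
Qed.

Lemma sectorL_J s x : 0 <= cross_dir s x -> cross_dir (s + b) x <= 0 ->
  0 <= cross_dir (s - b') x.
Proof.
move=> h0 h1; have [[p0 _ pp' _] _] := frameL h0 h1.
by move: (le_trans p0 pp'); rewrite /pL pmulr_lge0// invr_gt0 mulr_gt0.
Qed.

Lemma sectorR_J s x : 0 <= cross_dir (s + b) x -> cross_dir (s + 2 * t) x <= 0 ->
  cross_dir (s + 2 * t + b) x <= 0.
Proof.
move=> h0 h1; have [[p0 _ pp' _] _] := frameR h0 h1.
move: (le_trans p0 pp').
by rewrite /pR pmulr_lge0 ?invr_gt0 ?mulr_gt0// oppr_ge0.
Qed.

Lemma affine_near_cst x (v : 'cV[R]_2) (f : 'cV[R]_2 -> 'cV[R]_2) :
  (\forall y \near x, f y = v) -> affine_near f x 0.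
Proof.
move=> h; exists v; apply: (@filterS _ _ (nbhs_filter x) _ _ _ h) => y ->.
by rewrite mul0mx add0r.
Qed.

(** The strict inequalities that select one of the four values persist near [x].
    The first and last values do not occur between the polygons, since a
    half-sector meets the inner polygon where [lineI <= 0] and the outer one where
    [gaugeE <= 1]. *)
Lemma generic_affine_near x : generic_point x -> exists2 A : 'M[R]_2,
  affine_near interpolant x A &
  polygon n rE 0 x -> ~ polygon n rI b x ->
  exists k : int, A = grad_outer (ang k) \/ A = grad_edge (ang k).
Proof.
move=> gx; have [i [h0 h1]] := sector_cover n3 0 x.
have [[]] := gx i; move: h0 h1; rewrite !addr0; set k : int := i%:Z; set s := ang k.
move=> h0 h1 c0 cb c2 g1 [i1 i2 l1 l2].
have {}h0 : 0 < cross_dir s x by rewrite lt0r c0.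
have {}h1 : 0 < - cross_dir (s + 2 * t) x by rewrite oppr_gt0 lt_neqAle c2.
have aC s' := affine_cross_dir (R := R) s'.
have [hb|hb] := leP (cross_dir (s + b) x) 0.
  have {}hb : 0 < - cross_dir (s + b) x by rewrite oppr_gt0 lt_neqAle cb.
  have V y : 0 < cross_dir s y -> 0 < - cross_dir (s + b) y -> _ :=
    fun hy0 hyb => interpolantL (k := k) (x := y) (ltW hy0)
      (ltW (etrans (esym (oppr_gt0 _)) hyb)).
  have [li|li] := leP (lineI s x) 0.
    have {}li : 0 < - lineI s x by rewrite oppr_gt0 lt_neqAle i1.
    exists 0.
      apply: (affine_near_cst (v := 0)).
      apply: (near_gt0_4 (aC s) (affN (s + b)) (affine_funN (affine_lineI s))
        (affine_funN (affine_lineI s)) h0 hb li li).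
      by move=> y y1 y2 y3 _; have [V1 _ _ _] := V y y1 y2; apply: V1; rewrite -oppr_ge0 ltW.
    move=> _ nI; exfalso; apply: nI; apply: (lineI_polygon (s := s) (k := k)) => //.
    - by apply: sectorL_J; rewrite -?oppr_ge0 ltW.
    - by rewrite -oppr_ge0 ltW.
    - by rewrite -oppr_ge0 ltW.
  have [ll|ll] := leP (lineL s x) 0.
    have {}ll : 0 < - lineL s x by rewrite oppr_gt0 lt_neqAle l1.
    exists (grad_outer s); last by move=> _ _; exists k; left.
    exists (- ((eI - 1)^-1 *: vertexE s)).
    apply: (near_gt0_4 (aC s) (affN (s + b)) (affine_lineI s)
      (affine_funN (affine_lineL s)) h0 hb li ll).
    move=> y y1 y2 y3 y4; have [_ V1 _ _] := V y y1 y2.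
    by rewrite -grad_outer_affine V1 ?ltW// -oppr_gt0.
  have [lg|lg] := leP (gaugeE s x) 1.
    have {}lg : 0 < 1 - gaugeE s x.
      by rewrite subr_gt0 lt_neqAle lg andbT -subr_eq0.
    exists (grad_edge s); last by move=> _ _; exists k; right.
    exists (- ((1 - mE)^-1 *: vertexI s)).
    apply: (near_gt0_4 (aC s) (affN (s + b)) (affine_lineL s) (affG s) h0 hb ll lg).
    move=> y y1 y2 y3 y4; have [_ _ V1 _] := V y y1 y2.
    by rewrite -grad_edge_affine V1 ?ltW// -subr_gt0.
  have {}lg : 0 < gaugeE s x - 1 by rewrite subr_gt0.
  exists 1%:M.
    exists 0; apply: (near_gt0_4 (aC s) (affN (s + b)) (affG' s) (affG' s) h0 hb lg lg).
    move=> y y1 y2 y3 _; have [_ _ _ V1] := V y y1 y2.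
    by rewrite V1 ?mul1mx ?addr0// ltW// -subr_gt0.
  move=> /(gaugeE_polygon (s := s) (k := k) erefl).
  by rewrite leNgt -subr_gt0 lg.
have V y : 0 < cross_dir (s + b) y -> 0 < - cross_dir (s + 2 * t) y -> _ :=
  fun hy0 hyb => interpolantR (k := k) (x := y) (ltW hy0)
    (ltW (etrans (esym (oppr_gt0 _)) hyb)).
have sE : s + 2 * t = ang (k + 1) by rewrite angD ang1.
have [li|li] := leP (lineI (s + 2 * t) x) 0.
  have {}li : 0 < - lineI (s + 2 * t) x by rewrite oppr_gt0 lt_neqAle i2.
  exists 0.
    apply: (affine_near_cst (v := 0)).
    apply: (near_gt0_4 (aC (s + b)) (affN (s + 2 * t)) (affine_funN (affine_lineI _))
      (affine_funN (affine_lineI (s + 2 * t))) hb h1 li li).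
    by move=> y y1 y2 y3 _; have [V1 _ _ _] := V y y1 y2; apply: V1; rewrite -oppr_ge0 ltW.
  move=> _ nI; exfalso; apply: nI; apply: (lineI_polygon (s := s + 2 * t) (k := k + 1)) => //.
  - by rewrite (_ : _ - b' = s + b); [exact: ltW|ring].
  - by apply: sectorR_J; rewrite -?oppr_ge0 ltW.
  - by rewrite -oppr_ge0 ltW.
have [ll|ll] := leP (lineR s x) 0.
  have {}ll : 0 < - lineR s x by rewrite oppr_gt0 lt_neqAle l2.
  exists (grad_outer (s + 2 * t)); last by move=> _ _; exists (k + 1); left; rewrite sE.
  exists (- ((eI - 1)^-1 *: vertexE (s + 2 * t))).
  apply: (near_gt0_4 (aC (s + b)) (affN (s + 2 * t)) (affine_lineI _)
    (affine_funN (affine_lineR s)) hb h1 li ll).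
  move=> y y1 y2 y3 y4; have [_ V1 _ _] := V y y1 y2.
  by rewrite -grad_outer_affine V1 ?ltW// -oppr_gt0.
have [lg|lg] := leP (gaugeE s x) 1.
  have {}lg : 0 < 1 - gaugeE s x.
    by rewrite subr_gt0 lt_neqAle lg andbT -subr_eq0.
  exists (grad_edge s); last by move=> _ _; exists k; right.
  exists (- ((1 - mE)^-1 *: vertexI s)).
  apply: (near_gt0_4 (aC (s + b)) (affN (s + 2 * t)) (affine_lineR s) (affG s) hb h1 ll lg).
  move=> y y1 y2 y3 y4; have [_ _ V1 _] := V y y1 y2.
  by rewrite -grad_edge_affine V1 ?ltW// -subr_gt0.
have {}lg : 0 < gaugeE s x - 1 by rewrite subr_gt0.
exists 1%:M.
  exists 0; apply: (near_gt0_4 (aC (s + b)) (affN (s + 2 * t))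
    (affG' s) (affG' s) hb h1 lg lg).
  move=> y y1 y2 y3 _; have [_ _ _ V1] := V y y1 y2.
  by rewrite V1 ?mul1mx ?addr0// ltW// -subr_gt0.
move=> /(gaugeE_polygon (s := s) (k := k) erefl).
by rewrite leNgt -subr_gt0 lg.
Qed.

Lemma interpolant_outside x : ~ polygon n rE 0 x -> interpolant x = x.
Proof.
move=> nx; have [i [h0 h1]] := sector_cover n3 0 x.
have g1 : 1 <= gaugeE (ang i) x.
  rewrite leNgt; apply/negP => /ltW lg; apply: nx.
  apply: (sector_polygon n3 (k := i%:Z)) => //; rewrite addr0.
  by move: lg; rewrite /gaugeE ler_pdivrMr ?mulr_gt0// mul1r.
rewrite !addr0 in h0 h1.
have [hb|/ltW hb] := leP (cross_dir (ang i + b) x) 0.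
  by have [_ _ _ ->] := interpolantL h0 hb.
by have [_ _ _ ->] := interpolantR hb h1.
Qed.

Lemma polygon_lineI (k : int) x : polygon n rI b x -> lineI (ang k) x <= 0.
Proof.
move=> /(polygon_le n3 (k - 1) (ltW rI0)); rewrite /lineI subr_le0 angD.
rewrite (_ : _ + t = ang k - d); last first.
  by rewrite (_ : ang (-1) = - (2 * t)); [ring|rewrite /sector_angle mulrN1].
by rewrite ler_pdivrMr ?mulr_gt0// mul1r.
Qed.

Lemma interpolant_inside x : polygon n rI b x -> interpolant x = 0.
Proof.
move=> px; have [i [h0 h1]] := sector_cover n3 0 x.
rewrite !addr0 in h0 h1.
have [hb|/ltW hb] := leP (cross_dir (ang i + b) x) 0.
  by have [-> //] := interpolantL h0 hb; exact: polygon_lineI.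
have [-> //] := interpolantR hb h1.
by rewrite -ang1 -angD; exact: polygon_lineI.
Qed.

Lemma sin_sum_ge : rI * sin (2 * t) <= rE * (sin b + sin b').
Proof.
rewrite sin_sumE sin_half_angle2E !(mulrCA _ (2 * sin t)).
by rewrite ler_pM2l ?mulr_gt0// ltW.
Qed.

Lemma convex_hull3_le (f : 'cV[R]_2 -> R) (u v w x : 'cV[R]_2) : affine_fun f ->
  f u <= 0 -> f v <= 0 -> f w <= 0 -> convex_hull [set u; v; w] x -> f x <= 0.
Proof.
move=> [a [c [e E]]] fu fv fw; apply: convex_hull_le => [y z l|y].
  by rewrite !E !mxE; ring.
by move=> [[]|] ->.
Qed.

Lemma convex_hull3_ge (f : 'cV[R]_2 -> R) (u v w x : 'cV[R]_2) : affine_fun f ->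
  0 <= f u -> 0 <= f v -> 0 <= f w -> convex_hull [set u; v; w] x -> 0 <= f x.
Proof.
move=> af fu fv fw hx; rewrite -oppr_le0.
by apply: (convex_hull3_le (affine_funN af) _ _ _ hx); rewrite oppr_le0.
Qed.

Let tE0 s s' r : s' = s -> cross_dir s (r *: dir s') = 0.
Proof. by move=> ->; rewrite cross_dir_dir subrr sin0 mulr0. Qed.
Let cE r s s' w : s - s' = w -> cross_dir s' (r *: dir s) = r * sin w.
Proof. by move=> <-; rewrite cross_dir_dir. Qed.
Let dE r s s' w : s - s' = w -> dot_dir s' (r *: dir s) = r * cos w.
Proof. by move=> <-; rewrite dot_dir_dir. Qed.

(** The triangle straddles the direction of its outer vertex, so the formulas of
    the two adjacent half-sectors are needed. Their domains contain the triangle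
    because each is bounded by affine functions of constant sign on the three
    vertices. *)
Lemma interpolant_outer_triangle (k : int) x (s := ang k) :
  convex_hull [set vertexE s; vertexI (s - 2 * t); vertexI s] x ->
  interpolant x = (lineI s x / (eI - 1)) *: vertexE s.
Proof.
move=> hx.
have e1 := eI_gt1.
have I'E : s - 2 * t + b = s - b' by ring.
have hJ0 : 0 <= cross_dir (s - b') x.
  apply: convex_hull3_ge hx; first exact: affine_cross_dir.
  - by rewrite (@cE _ _ _ b'); [rewrite mulr_ge0// ltW|ring].
  - by rewrite tE0.
  - by rewrite (@cE _ _ _ (2 * t)); [rewrite mulr_ge0// ltW|ring].
have hJ1 : cross_dir (s + b) x <= 0.
  apply: convex_hull3_le hx; first exact: affine_cross_dir.
  - by rewrite (@cE _ _ _ (- b)); [rewrite sinN mulrN oppr_le0 mulr_ge0// ltW|ring].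
  - by rewrite (@cE _ _ _ (- (2 * t))); [rewrite sinN mulrN oppr_le0 mulr_ge0// ltW|ring].
  - by rewrite tE0.
have hI : 0 <= lineI s x.
  apply: convex_hull3_ge hx; first exact: affine_lineI.
  - by rewrite /lineI (@dE _ _ _ d); [rewrite subr_ge0 ltW|ring].
  - rewrite /lineI (@dE _ _ _ (- t)); last by ring.
    by rewrite cosN divff ?subrr// mulf_neq0.
  - rewrite /lineI (@dE _ _ _ t); last by ring.
    by rewrite divff ?subrr// mulf_neq0.
have hL : lineL s x <= 0.
  apply: convex_hull3_le hx; first exact: affine_lineL.
  - rewrite /lineL /pR /qL (@cE _ _ _ (- b)); last by ring.
    by rewrite tE0// sinN mulrN opprK divff ?mulf_neq0// mul0r addr0 subrr.
  - rewrite /lineL /pR /qL (@cE _ _ _ (- (2 * t))); last by ring.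
    rewrite (@cE _ _ _ (- b')); last by ring.
    rewrite !sinN (_ : _ - 1 = (rI * sin (2 * t) - rE * (sin b + sin b')) / (rE * sin b)).
      by rewrite pmulr_lle0 ?invr_gt0 ?mulr_gt0// subr_le0 sin_sum_ge.
    by field; rewrite rIN rEN sbN.
  - rewrite /lineL /pR /qL tE0// (@cE _ _ _ b); last by ring.
    by rewrite divff ?mulf_neq0// oppr0 mul0r add0r subrr.
have hR : lineR (s - 2 * t) x <= 0.
  apply: convex_hull3_le hx; first exact: affine_lineR.
  - rewrite /lineR /pL /qR subrK (@cE _ _ _ b'); last by ring.
    by rewrite tE0// divff ?mulf_neq0// oppr0 mul0r addr0 subrr.
  - rewrite /lineR /pL /qR subrK tE0// (@cE _ _ _ (- b')); last by ring.
    by rewrite sinN mulrN opprK divff ?mulf_neq0// mul0r add0r subrr.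
  - rewrite /lineR /pL /qR subrK (@cE _ _ _ (2 * t)); last by ring.
    rewrite (@cE _ _ _ b); last by ring.
    rewrite (_ : _ - 1 = (rI * sin (2 * t) - rE * (sin b + sin b')) / (rE * sin b')).
      by rewrite pmulr_lle0 ?invr_gt0 ?mulr_gt0// subr_le0 sin_sum_ge.
    by field; rewrite rIN rEN sb'N.
have [h0|/ltW h0] := leP 0 (cross_dir s x).
  by have [_ -> ] := interpolantL h0 hJ1.
have sE : s - 2 * t = ang (k - 1).
  by rewrite angD (_ : ang (-1) = - (2 * t))// /sector_angle mulrN1.
have ssE : ang (k - 1) + 2 * t = s by rewrite -sE subrK.
have := @interpolantR (k - 1) x; rewrite ssE -sE I'E => /(_ hJ0 h0) [_ V _ _].
exact: V.
Qed.

(** This triangle straddles the direction of its inner vertex. *)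
Lemma interpolant_edge_triangle (k : int) x (s := ang k) :
  convex_hull [set vertexE s; vertexI s; vertexE (s + 2 * t)] x ->
  interpolant x = x - ((1 - gaugeE s x) / (1 - mE)) *: vertexI s.
Proof.
move=> hx.
have m1 := mE_lt1.
have sbE : s + 2 * t - b' = s + b by ring.
have h0 : 0 <= cross_dir s x.
  apply: convex_hull3_ge hx; first exact: affine_cross_dir.
  - by rewrite tE0.
  - by rewrite (@cE _ _ _ b); [rewrite mulr_ge0// ltW|ring].
  - by rewrite (@cE _ _ _ (2 * t)); [rewrite mulr_ge0// ltW|ring].
have h1 : cross_dir (s + 2 * t) x <= 0.
  apply: convex_hull3_le hx; first exact: affine_cross_dir.
  - by rewrite (@cE _ _ _ (- (2 * t))); [rewrite sinN mulrN oppr_le0 mulr_ge0// ltW|ring].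
  - by rewrite (@cE _ _ _ (- b')); [rewrite sinN mulrN oppr_le0 mulr_ge0// ltW|ring].
  - by rewrite tE0.
have hG : gaugeE s x <= 1.
  rewrite -subr_le0.
  apply: (convex_hull3_le (affG' s) _ _ _ hx); rewrite /gaugeE subr_le0.
  - rewrite (@dE _ _ _ (- t)); last by ring.
    by rewrite cosN divff// mulf_neq0.
  - by rewrite (@dE _ _ _ (- d)); [rewrite cosN ltW|ring].
  - rewrite (@dE _ _ _ t); last by ring.
    by rewrite divff// mulf_neq0.
have hL : 0 <= lineL s x.
  apply: convex_hull3_ge hx; first exact: affine_lineL.
  - rewrite /lineL /pR /qL (@cE _ _ _ (- b)); last by ring.
    by rewrite tE0// sinN mulrN opprK divff ?mulf_neq0// mul0r addr0 subrr.
  - rewrite /lineL /pR /qL tE0// (@cE _ _ _ b); last by ring.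
    by rewrite divff ?mulf_neq0// oppr0 mul0r add0r subrr.
  - rewrite /lineL /pR /qL (@cE _ _ _ b'); last by ring.
    rewrite (@cE _ _ _ (2 * t)); last by ring.
    rewrite (_ : _ - 1 = (rE * sin (2 * t) - rI * (sin b + sin b')) / (rI * sin b)).
      by rewrite pmulr_lge0 ?invr_gt0 ?mulr_gt0// subr_ge0 sin_sum_le.
    by field; rewrite rIN rEN sbN.
have hR : 0 <= lineR s x.
  apply: convex_hull3_ge hx; first exact: affine_lineR.
  - rewrite /lineR /pL /qR sbE (@cE _ _ _ (- b)); last by ring.
    rewrite (@cE _ _ _ (- (2 * t))); last by ring.
    rewrite !sinN (_ : _ - 1 = (rE * sin (2 * t) - rI * (sin b + sin b')) / (rI * sin b')).
      by rewrite pmulr_lge0 ?invr_gt0 ?mulr_gt0// subr_ge0 sin_sum_le.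
    by field; rewrite rIN rEN sb'N.
  - rewrite /lineR /pL /qR sbE tE0// (@cE _ _ _ (- b')); last by ring.
    by rewrite sinN mulrN opprK divff ?mulf_neq0// mul0r add0r subrr.
  - rewrite /lineR /pL /qR sbE (@cE _ _ _ b'); last by ring.
    by rewrite tE0// divff ?mulf_neq0// oppr0 mul0r addr0 subrr.
have [hb|/ltW hb] := leP (cross_dir (s + b) x) 0.
  by have [_ _ -> ] := interpolantL h0 hb.
by have [_ _ -> ] := interpolantR hb h1.
Qed.

End Interpolant.

(** * Rotations, similarities and reflections *)
Section PlaneMatrices.
Context {R : realType}.
Implicit Types (A B : 'M[R]_2) (v w : 'cV[R]_2) (s : R).

Lemma mulmx2 (p q : nat) (A : 'M[R]_(p, 2)) (B : 'M[R]_(2, q)) i j :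
  (A *m B) i j = A i 0 * B 0 j + A i 1 * B 1 j.
Proof. by rewrite mxE sum_I2. Qed.

Lemma mx2P A B : A 0 0 = B 0 0 -> A 0 1 = B 0 1 -> A 1 0 = B 1 0 -> A 1 1 = B 1 1 ->
  A = B.
Proof.
move=> h00 h01 h10 h11; apply/matrixP => i j.
have I2 (k : 'I_2) : k = 0 \/ k = 1.
  by case: k => -[|[|//]] ?; [left|right]; exact: val_inj.
by have [->|->] := I2 i; have [->|->] := I2 j.
Qed.

Lemma det2 A : \det A = A 0 0 * A 1 1 - A 0 1 * A 1 0.
Proof.
rewrite (expand_det_row _ 0) sum_I2 /cofactor !det_mx11 !mxE /= expr0 expr1.
rewrite (_ : lift 0 0 = 1 :> 'I_2); last exact: val_inj.
by rewrite (_ : lift 1 0 = 0 :> 'I_2); [ring|exact: val_inj].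
Qed.

Definition rot90 : 'M[R]_2 := rotmx (pi / 2).

Lemma rot90_mul v : rot90 *m v = vec2 (- v 1 0) (v 0 0).
Proof. by apply: cV2P; rewrite mulmx2 !mxE/= cos_pihalf sin_pihalf; ring. Qed.

Lemma rotmx_dir s s' (r : R) : rotmx s *m (r *: dir s') = r *: dir (s' + s).
Proof. by apply: cV2P; rewrite mulmx2 !mxE/= ?cosD ?sinD; ring. Qed.

Lemma rotmxD s s' : rotmx (s + s') = rotmx s *m rotmx s' :> 'M[R]_2.
Proof. by apply: mx2P; rewrite mulmx2 !mxE/= ?cosD ?sinD; ring. Qed.

Lemma rotmx0 : rotmx 0 = 1%:M :> 'M[R]_2.
Proof. by apply: mx2P; rewrite !mxE/= ?cos0 ?sin0 ?oppr0. Qed.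

Lemma trmx_rotmx s : (rotmx s)^T = rotmx (- s) :> 'M[R]_2.
Proof. by apply: mx2P; rewrite !mxE/= ?cosN ?sinN ?opprK. Qed.

Lemma rotmx_period (q : int) s : rotmx (s + 2 * pi * q%:~R) = rotmx s :> 'M[R]_2.
Proof. by apply: mx2P; rewrite !mxE/= ?cos_period ?sin_period. Qed.

Lemma sqr_norm_neq0 v : v != 0 -> v 0 0 ^+ 2 + v 1 0 ^+ 2 != 0.
Proof.
apply: contra; rewrite paddr_eq0 ?sqr_ge0// !sqrf_eq0 => /andP[/eqP h0 /eqP h1].
by apply/eqP/cV2P; rewrite mxE.
Qed.

(** A nonzero vector and its quarter turn form a basis. *)
Lemma mx_eq_frame A B v : v != 0 -> A *m v = B *m v ->
  A *m (rot90 *m v) = B *m (rot90 *m v) -> A = B.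
Proof.
move=> /sqr_norm_neq0 N0; rewrite rot90_mul => e1 e2.
have row i : A i 0 = B i 0 /\ A i 1 = B i 1.
  have := congr1 (fun u : 'cV_2 => u i 0) e1; have := congr1 (fun u : 'cV_2 => u i 0) e2.
  rewrite !mulmx2 vec2E0 vec2E1 => h2 h1; split; apply: (mulIf N0).
    transitivity ((A i 0 * v 0 0 + A i 1 * v 1 0) * v 0 0 -
      (A i 0 * - v 1 0 + A i 1 * v 0 0) * v 1 0); first by ring.
    by rewrite h1 h2; ring.
  transitivity ((A i 0 * v 0 0 + A i 1 * v 1 0) * v 1 0 +
      (A i 0 * - v 1 0 + A i 1 * v 0 0) * v 0 0); first by ring.
  by rewrite h1 h2; ring.
by have [h00 h01] := row 0; have [h10 h11] := row 1; exact: mx2P.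
Qed.

(** The quotient [w / v] of complex numbers, as a matrix. *)
Definition similarity_to v w : 'M[R]_2 :=
  let N := v 0 0 ^+ 2 + v 1 0 ^+ 2 in
  ((v 0 0 * w 0 0 + v 1 0 * w 1 0) / N) *: 1%:M +
  ((v 0 0 * w 1 0 - v 1 0 * w 0 0) / N) *: rot90.

Lemma similarity_toE v w : v != 0 -> similarity_to v w *m v = w.
Proof.
move=> /sqr_norm_neq0 N0; rewrite /similarity_to mulmxDl -!scalemxAl mul1mx rot90_mul.
by apply: cV2P; rewrite !mxE/=; field.
Qed.

Lemma similarity_to_rot90 v w (u : 'cV[R]_2) :
  similarity_to v w *m (rot90 *m u) = rot90 *m (similarity_to v w *m u).
Proof. by rewrite /similarity_to !mulmxDl !mulmxDr -!scalemxAl -!scalemxAr !mul1mx. Qed.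

Lemma similarity_to_rotmx v w s :
  similarity_to v w *m rotmx s = rotmx s *m similarity_to v w.
Proof.
rewrite /similarity_to mulmxDl mulmxDr -!scalemxAl -!scalemxAr mul1mx mulmx1.
by rewrite /rot90 -!rotmxD (addrC s).
Qed.

Lemma similarity_to_SO2 v w : v != 0 ->
  v 0 0 ^+ 2 + v 1 0 ^+ 2 = w 0 0 ^+ 2 + w 1 0 ^+ 2 -> SO2 (similarity_to v w).
Proof.
move=> /sqr_norm_neq0 N0 vw.
have C : ((v 0 0 * w 0 0 + v 1 0 * w 1 0) / (v 0 0 ^+ 2 + v 1 0 ^+ 2)) ^+ 2 +
    ((v 0 0 * w 1 0 - v 1 0 * w 0 0) / (v 0 0 ^+ 2 + v 1 0 ^+ 2)) ^+ 2 = 1.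
  rewrite !expr_div_n -mulrDl.
  set N := (X in _ / X ^+ 2 = _); rewrite [X in X / _](_ : _ = N * N).
    by rewrite -expr2 divff// expf_neq0.
  transitivity (N * (w 0 0 ^+ 2 + w 1 0 ^+ 2)); first by rewrite /N; ring.
  by rewrite -vw.
move: C; rewrite /SO2 /similarity_to /=; set p := _ / _; set q := (_ - _) / _.
clearbody p q => C; split; last first.
  by rewrite det2 !mxE/= cos_pihalf sin_pihalf -[RHS]C; ring.
by apply: mx2P; rewrite mulmx2 !mxE/= cos_pihalf sin_pihalf;
  [rewrite -[RHS]C; ring|ring|ring|rewrite -[RHS]C; ring].
Qed.

End PlaneMatrices.

Section OrthonormalFrame.
Context {R : realType}.
Variable v : 'cV[R]_2.
Hypothesis v0 : v != 0.
Local Notation e := ((enorm v)^-1 *: v).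
Local Notation e' := (rot90 *m e).

Lemma outer_mul (p q x : 'cV[R]_2) :
  outer p q *m x = (q 0 0 * x 0 0 + q 1 0 * x 1 0) *: p.
Proof.
rewrite /outer -mulmxA [X in p *m X]mx11_scalar mul_mx_scalar; congr (_ *: p).
by rewrite mulmx2 !mxE.
Qed.

Let l := enorm v.

Lemma enorm_sqr : l ^+ 2 = v 0 0 ^+ 2 + v 1 0 ^+ 2.
Proof. by rewrite /l /enorm sum_I2 sqr_sqrtr// addr_ge0// sqr_ge0. Qed.

Lemma enorm_neq0 : l != 0.
Proof. by rewrite -sqrf_eq0 enorm_sqr sqr_norm_neq0. Qed.

Let l0 := enorm_neq0.
Let eE : l *: e = v. Proof. by rewrite scalerA mulfV// scale1r. Qed.
Let e'E : l *: e' = rot90 *m v. Proof. by rewrite scalemxAr eE. Qed.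

Let dot_e_v : e 0 0 * v 0 0 + e 1 0 * v 1 0 = l.
Proof.
rewrite !mxE -/l; apply: (mulfI l0).
by rewrite -[RHS]expr2 enorm_sqr; field.
Qed.
Let dot_e'_v : e' 0 0 * v 0 0 + e' 1 0 * v 1 0 = 0.
Proof. by rewrite rot90_mul !mxE/=; ring. Qed.
Let dot_e_v' : e 0 0 * (rot90 *m v) 0 0 + e 1 0 * (rot90 *m v) 1 0 = 0.
Proof. by rewrite rot90_mul !mxE/=; ring. Qed.
Let dot_e'_v' : e' 0 0 * (rot90 *m v) 0 0 + e' 1 0 * (rot90 *m v) 1 0 = l.
Proof.
rewrite !rot90_mul !mxE/= -/l; apply: (mulfI l0).
by rewrite -[RHS]expr2 enorm_sqr; field.
Qed.

Lemma frame_stretch_v (a c k : R) :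
  (a *: outer e e + c *: outer e' e' + k *: outer e e') *m v = a *: v.
Proof.
rewrite !mulmxDl -!scalemxAl !outer_mul dot_e_v dot_e'_v.
by rewrite !scale0r !scaler0 !addr0 eE.
Qed.

Lemma frame_stretch_v' (a c k : R) :
  (a *: outer e e + c *: outer e' e' + k *: outer e e') *m (rot90 *m v) =
  c *: (rot90 *m v) + k *: v.
Proof.
rewrite !mulmxDl -!scalemxAl !outer_mul dot_e_v' dot_e'_v'.
by rewrite scale0r scaler0 add0r e'E eE.
Qed.

Definition reflection : 'M[R]_2 := outer e e - outer e' e'.

Lemma reflection_frame : reflection = 1 *: outer e e + (-1) *: outer e' e' + 0 *: outer e e'.
Proof. by rewrite scale1r scaleN1r scale0r addr0. Qed.

Lemma reflection_v : reflection *m v = v.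
Proof. by rewrite reflection_frame frame_stretch_v scale1r. Qed.

Lemma reflection_v' : reflection *m (rot90 *m v) = - (rot90 *m v).
Proof. by rewrite reflection_frame frame_stretch_v' scale0r addr0 scaleN1r. Qed.

Lemma trmx_reflection : reflection^T = reflection.
Proof. by rewrite /reflection linearB/= /outer !trmx_mul !trmxK. Qed.

Lemma outerE (p q : 'cV[R]_2) i j : outer p q i j = p i 0 * q j 0.
Proof. by rewrite /outer mxE big_ord1 mxE. Qed.

Lemma reflectionE i j : reflection i j = e i 0 * e j 0 - e' i 0 * e' j 0.
Proof. by rewrite -!outerE mxE [X in _ + X]mxE. Qed.

(** The entries of a reflection in a line are those of a symmetric traceless
    matrix, for which the relation is a computation. *)
Lemma rotmx_reflection s : rotmx s *m reflection = reflection *m rotmx (- s).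
Proof.
have H00 : reflection 1 1 = - reflection 0 0.
  by rewrite !reflectionE rot90_mul !mxE/=; ring.
have H01 : reflection 1 0 = reflection 0 1 by rewrite -{1}trmx_reflection mxE.
move: H00 H01; set F := reflection; clearbody F => H00 H01.
by apply: mx2P; rewrite !mulmx2 !mxE/= ?cosN ?sinN ?H00 ?H01; ring.
Qed.

Section TwoStretches.
Variables (w : 'cV[R]_2) (G : 'M[R]_2) (a S c : R).
Hypotheses (a0 : a != 0) (c0 : c != 0).
Local Notation kappa := ((a^-1 - a) * (S / c)).
Local Notation U := (a *: outer e e + a^-1 *: outer e' e' + kappa *: outer e e').
Hypothesis Gv : G *m v = a *: w.

(** [U] stretches [v] by [a] and the oblique direction [S v + c v'] by [1/a], where
    [v'] is the quarter turn of [v]. So [G] is [U] up to the similarity [v -> w]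
    as soon as it sends these two directions to the corresponding ones. *)
Lemma two_stretches :
  G *m (a *: (S *: v + c *: (rot90 *m v))) = S *: w + c *: (rot90 *m w) ->
  G = similarity_to v w *m U.
Proof.
move=> Gf; apply: (mx_eq_frame v0).
  by rewrite Gv -mulmxA frame_stretch_v -scalemxAr similarity_toE.
rewrite -[RHS]mulmxA frame_stretch_v' mulmxDr -!scalemxAr similarity_to_rot90 similarity_toE//.
have acN : a * c != 0 by rewrite mulf_neq0.
apply: (scalerI acN); move: Gf.
rewrite -scalemxAr mulmxDr -!scalemxAr Gv scalerDr !scalerA => h.
have -> : (a * c) *: (G *m (rot90 *m v)) =
    S *: w + c *: (rot90 *m w) - (a * S * a) *: w.
  by rewrite -h ?mulrA addrAC subrr add0r.
rewrite scalerDr !scalerA addrAC -scalerBl addrC.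
by congr (_ *: _ + _ *: _); field; rewrite ?a0 ?c0.
Qed.

(** Conjugation by the reflection in the line of [v] changes the oblique direction
    into [S v - c v']. *)
Lemma two_stretches_reflected :
  G *m (a *: (S *: v - c *: (rot90 *m v))) = S *: w - c *: (rot90 *m w) ->
  G = similarity_to v w *m (reflection *m U *m reflection^T).
Proof.
move=> Gf; rewrite trmx_reflection; apply: (mx_eq_frame v0).
  rewrite Gv -!mulmxA reflection_v frame_stretch_v -scalemxAr reflection_v.
  by rewrite -scalemxAr similarity_toE.
have -> : similarity_to v w *m (reflection *m U *m reflection) *m (rot90 *m v) =
    a^-1 *: (rot90 *m w) - kappa *: w.
  rewrite -!mulmxA reflection_v' !mulmxN frame_stretch_v' !mulmxDr -!scalemxAr.
  rewrite reflection_v' reflection_v mulmxN scalerN.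
  by rewrite similarity_to_rot90 similarity_toE// opprD opprK.
have acN : a * c != 0 by rewrite mulf_neq0.
apply: (scalerI acN); move: Gf.
rewrite -scalemxAr mulmxBr -!scalemxAr Gv scalerBr !scalerA => h.
have -> : (a * c) *: (G *m (rot90 *m v)) =
    (a * S * a) *: w - (S *: w - c *: (rot90 *m w)).
  by rewrite -h ?mulrA opprB addrC subrK.
rewrite scalerBr !scalerA opprB addrCA -scalerBl -scaleNr.
by congr (_ *: _ + _ *: _); field; rewrite ?a0 ?c0.
Qed.

End TwoStretches.

End OrthonormalFrame.

(** * The two kinds of gradient are in the wells *)
Section Wells.
Context {R : realType} (n : nat) (b rE rI a sg : R).
Local Notation t := (@half_angle R n).
Hypothesis n3 : (3 <= n)%N.
Hypothesis b_gt0 : 0 < b.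
Hypothesis b_lt : b < 2 * t.
Hypothesis rI0 : 0 < rI.
Hypothesis rE0 : 0 < rE.
Local Notation b' := (2 * t - b).
Local Notation d := (t - b).
Hypothesis outside : rI * cos t < rE * cos d.
Hypothesis inside : rI * cos d < rE * cos t.
Hypothesis sg0 : 0 < sg.
Hypothesis a0 : 0 < a.
(* With [sg] the square root of [sin b * sin b'], the first relation is the
   formula for [rI / rE]; the second one follows from it. *)
Hypothesis rel_outer : sg * rE = rE * cos d - rI * cos t.
Hypothesis rel_inner : sg * rI = rE * cos t - rI * cos d.
Hypothesis a_sg : a * sg = sin b'.

Local Notation vertexE := (vertexE rE).
Local Notation vertexI := (vertexI b rI).
Local Notation v := (vertexI 0 - vertexE 0).
Local Notation sv := (vec2 (v 0 0) (- v 1 0)).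
Local Notation w := (sin t *: sv - cos t *: (rot90 *m sv)).

Let ct : cos t != 0. Proof. by rewrite gt_eqF// cos_half_angle_gt0. Qed.
Let aN : a != 0. Proof. by rewrite gt_eqF. Qed.
Let CS : cos t ^+ 2 + sin t ^+ 2 = 1. Proof. exact: cos2Dsin2. Qed.
Let CSd : cos d ^+ 2 + sin d ^+ 2 = 1. Proof. exact: cos2Dsin2. Qed.
Let cb : cos b = cos t * cos d + sin t * sin d.
Proof. by rewrite -cosB; congr cos; ring. Qed.
Let sb : sin b = sin t * cos d - cos t * sin d.
Proof. by rewrite -sinB; congr sin; ring. Qed.
Let cb' : cos b' = cos t * cos d - sin t * sin d.
Proof. by rewrite -cosD; congr cos; ring. Qed.
Let sb' : sin b' = sin t * cos d + cos t * sin d.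
Proof. by rewrite -sinD; congr sin; ring. Qed.

Let v0E : v 0 0 = rI * cos b - rE.
Proof. by rewrite !mxE/= add0r cos0 mulr1. Qed.
Let v1E : v 1 0 = rI * sin b.
Proof. by rewrite !mxE/= add0r sin0 mulr0 subr0. Qed.

Lemma edge_neq0 : v != 0.
Proof.
apply/eqP => /(congr1 (fun u : 'cV_2 => u 1 0)); rewrite v1E mxE => /eqP.
by rewrite mulf_eq0 !gt_eqF// (sinb_gt0 n3 b_gt0 b_lt).
Qed.

(** The edge from [vertexE 0] to the previous inner vertex is [a] times the edge
    [v] to the next one, turned by [pi/2 - t]. *)
Lemma other_edge : vertexI (- (2 * t)) - vertexE 0 = a *: (sin t *: v + cos t *: (rot90 *m v)).
Proof.
have sgN : sg != 0 by rewrite gt_eqF.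
rewrite rot90_mul; apply: cV2P.
  rewrite [RHS]mxE [in RHS]mxE [in X in _ = a * (X + _)]mxE.
  rewrite [in X in _ = a * (_ + X)]mxE vec2E0 v0E v1E.
  rewrite !mxE/= (_ : - (2 * t) + b = - b'); last by ring.
  rewrite cosN cos0; apply: (mulfI sgN).
  transitivity (sin b' * (rI * sin d - sin t * rE)).
    rewrite mulrBr mulrA rel_inner mulr1 rel_outer.
    transitivity (rE * (cos t * cos b' - cos d) + rI * (cos t - cos d * cos b')).
      by ring.
    have -> : cos t * cos b' - cos d = - (sin t * sin b').
      rewrite cb' sb'; transitivity (- (sin t ^+ 2 * cos d + sin t * cos t * sin d) +
        (cos t ^+ 2 + sin t ^+ 2 - 1) * cos d); first by ring.
      by rewrite CS; ring.
    have -> : cos t - cos d * cos b' = sin d * sin b'.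
      rewrite cb' sb'; transitivity (sin d * (sin t * cos d + cos t * sin d) +
        (1 - (cos d ^+ 2 + sin d ^+ 2)) * cos t); first by ring.
      by rewrite CSd; ring.
    by ring.
  rewrite -a_sg cb sb.
  transitivity (a * sg * (rI * sin d * (cos t ^+ 2 + sin t ^+ 2) - sin t * rE)).
    by rewrite CS; ring.
  by ring.
rewrite [RHS]mxE [in RHS]mxE [in X in _ = a * (X + _)]mxE.
rewrite [in X in _ = a * (_ + X)]mxE vec2E1 v0E v1E.
rewrite !mxE/= (_ : - (2 * t) + b = - b'); last by ring.
rewrite sinN sin0 mulr0 subr0 -a_sg.
transitivity (- a * (sg * rI)); first by ring.
rewrite rel_inner cb sb.
transitivity (a * (rI * cos d * (cos t ^+ 2 + sin t ^+ 2) - rE * cos t)).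
  by rewrite CS; ring.
by ring.
Qed.

Local Notation Rs := (rotmx (2 * d)).

(** With [i] for the quarter turn, this is
    [(cos t + i sin t)^2 (sin t + i cos t) = i cos t - sin t]. *)
Lemma turn_combination (u : 'cV[R]_2) :
  rotmx (2 * t) *m (sin t *: u + cos t *: (rot90 *m u)) =
  cos t *: (rot90 *m u) - sin t *: u.
Proof.
have c2 : cos (2 * t) = cos t ^+ 2 - sin t ^+ 2.
  by rewrite (_ : 2 * t = t + t) ?cosD; ring.
have s2 : sin (2 * t) = 2 * sin t * cos t.
  by rewrite (_ : 2 * t = t + t) ?sinD; ring.
rewrite rot90_mul; apply: cV2P; rewrite mulmx2 !mxE/= c2 s2.
  transitivity ((cos t ^+ 2 + sin t ^+ 2) * (- sin t * u 0 0 - cos t * u 1 0)); first by ring.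
  by rewrite CS; ring.
transitivity ((cos t ^+ 2 + sin t ^+ 2) * (- sin t * u 1 0 + cos t * u 0 0)); first by ring.
by rewrite CS; ring.
Qed.

Lemma reflected_edge : sin t *: w + cos t *: (rot90 *m w) = sv.
Proof.
have E (u : 'cV[R]_2) : sin t *: (sin t *: u - cos t *: (rot90 *m u)) +
    cos t *: (rot90 *m (sin t *: u - cos t *: (rot90 *m u))) = u.
  rewrite !rot90_mul; apply: cV2P; rewrite !mxE/=.
    transitivity ((cos t ^+ 2 + sin t ^+ 2) * u 0 0); first by ring.
    by rewrite CS mul1r.
  transitivity ((cos t ^+ 2 + sin t ^+ 2) * u 1 0); first by ring.
  by rewrite CS mul1r.
exact: E.
Qed.

Lemma norm_w : v 0 0 ^+ 2 + v 1 0 ^+ 2 = w 0 0 ^+ 2 + w 1 0 ^+ 2.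
Proof.
have E (u : 'cV[R]_2) (z := sin t *: u - cos t *: (rot90 *m u)) :
    z 0 0 ^+ 2 + z 1 0 ^+ 2 = u 0 0 ^+ 2 + u 1 0 ^+ 2.
  rewrite /z rot90_mul !mxE/=.
  transitivity ((cos t ^+ 2 + sin t ^+ 2) * (u 0 0 ^+ 2 + u 1 0 ^+ 2)); first by ring.
  by rewrite CS mul1r.
by rewrite E vec2E0 vec2E1 sqrrN.
Qed.

(** [w] is [1/a] times the mirror image of the other edge, and the rotation
    by [2 d] takes [vertexI 0] to the mirror image of [vertexI (- (2 * t))]. *)
Lemma image_edge : Rs *m vertexI 0 - vertexE 0 = a *: w.
Proof.
have := other_edge; set o := vertexI _ - _ => oE.
have -> : Rs *m vertexI 0 - vertexE 0 = vec2 (o 0 0) (- o 1 0).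
  rewrite /vertexI rotmx_dir (_ : 0 + b + 2 * d = b'); last by ring.
  rewrite /o (_ : - (2 * t) = 0 - b' - b); last by ring.
  rewrite /vertexI subrK sub0r.
  by apply: cV2P; rewrite !mxE/= ?cosN ?sinN ?sin0; ring.
move: (v) oE; clear => u ->; rewrite !rot90_mul.
by apply: cV2P; rewrite !mxE/=; ring.
Qed.

Lemma image_other_edge : Rs *m vertexI (- (2 * t)) - vertexE 0 = sv.
Proof.
rewrite v0E v1E /vertexI rotmx_dir (_ : _ + 2 * d = - b); last by ring.
by apply: cV2P; rewrite !mxE/= ?cosN ?sinN ?sin0 ?cos0; ring.
Qed.

(** The third edge is the other edge turned by [pi + 2 t], so [other_edge]
    applies again. *)
Lemma edge_third : vertexE (2 * t) - vertexI 0 = a *: (sin t *: v - cos t *: (rot90 *m v)).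
Proof.
have -> : vertexE (2 * t) - vertexI 0 = - (rotmx (2 * t) *m (vertexI (- (2 * t)) - vertexE 0)).
  rewrite mulmxBr /vertexE /vertexI !rotmx_dir opprB; congr (_ *: dir _ - _ *: dir _); ring.
by rewrite other_edge -scalemxAr turn_combination -scalerN opprB.
Qed.

Lemma image_third : vertexE (2 * t) - Rs *m vertexI 0 = - (rotmx (2 * t) *m sv).
Proof.
rewrite -image_other_edge mulmxBr mulmxA -rotmxD /vertexE /vertexI !rotmx_dir opprB.
congr (_ *: dir _ - _ *: dir _); ring.
Qed.

Local Notation gE := (grad_outer n b rE rI).
Local Notation gI := (grad_edge n b rE rI).

Let nI : rI * cos t != 0. Proof. by rewrite mulf_neq0// gt_eqF. Qed.
Let nE : rE * cos t != 0. Proof. by rewrite mulf_neq0// gt_eqF. Qed.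

Let cE : rI * cos t * (eI n b rE rI - 1) = rE * cos d - rI * cos t.
Proof. by rewrite mulrBr mulr1 /eI mulrC divfK. Qed.
Let cI : rE * cos t * (1 - mE n b rE rI) = rE * cos t - rI * cos d.
Proof. by rewrite mulrBr mulr1 /mE [_ * (_ / _)]mulrC divfK. Qed.

Let dotB s (x y : 'cV[R]_2) : dot_dir s (x - y) = dot_dir s x - dot_dir s y.
Proof. by rewrite /dot_dir !mxE; ring. Qed.

Lemma grad_outer_mul s : dot_dir (- d) (vertexI s) = rI * cos t ->
  gE 0 *m (vertexI s - vertexE 0) = - vertexE 0.
Proof.
move=> Is; rewrite /grad_outer -scalemxAl sub0r outer_dir scalerA cE.
rewrite dotB Is dot_dir_dir sub0r opprK.
rewrite -(opprB (rE * _)) mulrN mulVf ?scaleN1r//.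
by rewrite subr_eq0 gt_eqF.
Qed.

Lemma grad_edge_mul1 : gI 0 *m v = - vertexE 0.
Proof.
rewrite /grad_edge mulmxDl mul1mx -scalemxAl add0r outer_dir scalerA cI.
rewrite dotB !dot_dir_dir.
rewrite (_ : 0 + b - t = - d); last by ring.
rewrite sub0r !cosN -(opprB (rE * _)) mulrN mulVf; last by rewrite subr_eq0 gt_eqF.
by rewrite scaleN1r addrAC subrr sub0r.
Qed.

Lemma grad_edge_mul2 : gI 0 *m (vertexE (2 * t) - vertexI 0) = vertexE (2 * t).
Proof.
rewrite /grad_edge mulmxDl mul1mx -scalemxAl add0r outer_dir scalerA cI.
rewrite dotB !dot_dir_dir.
rewrite (_ : 0 + b - t = - d); last by ring.
rewrite (_ : 2 * t - t = t); last by ring.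
rewrite cosN mulVf; last by rewrite subr_eq0 gt_eqF.
by rewrite scale1r subrK.
Qed.

Local Notation e := ((enorm v)^-1 *: v).
Local Notation e' := (rot90 *m e).
Local Notation kappa := ((a^-1 - a) * (sin t / cos t)).
Local Notation U := (a *: outer e e + a^-1 *: outer e' e' + kappa *: outer e e').
Local Notation Q := (similarity_to v w).
Local Notation H := (reflection v).

Let mulDM (X Y Z : 'M[R]_2) (z : 'cV[R]_2) :
  (X + Y *m Z) *m z = X *m z + Y *m (Z *m z).
Proof. by rewrite mulmxDl mulmxA. Qed.

(** The gradient takes the two edges at [vertexE 0] to each other's mirror
    images. *)
Lemma outer_gradient_well : Rs + (1%:M - Rs) *m gE 0 = Q *m U.
Proof.
have act (z : 'cV[R]_2) : gE 0 *m z = - vertexE 0 ->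
    (Rs + (1%:M - Rs) *m gE 0) *m z = Rs *m (z + vertexE 0) - vertexE 0.
  move=> gz; rewrite mulDM gz mulmxBl mul1mx mulmxN opprK mulmxDr.
  by rewrite [- _ + _]addrC addrA.
apply: (two_stretches edge_neq0 aN ct).
  rewrite act ?subrK ?image_edge//; apply: grad_outer_mul.
  by rewrite dot_dir_dir (_ : _ - - d = t)//; ring.
rewrite -other_edge reflected_edge act ?subrK ?image_other_edge//.
by apply: grad_outer_mul; rewrite dot_dir_dir -[cos t]cosN (_ : _ - - d = - t)//; ring.
Qed.

(** The gradient takes the two edges at [vertexI 0] to each other's mirror images
    in the bisector of the outer edge. The similarity is the same as on the outer
    triangle, because the two triangles share the edge [v]. *)
Lemma edge_gradient_well : Rs + (1%:M - Rs) *m gI 0 = Q *m (H *m U *m H^T).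
Proof.
apply: (two_stretches_reflected edge_neq0 aN ct).
  rewrite mulDM grad_edge_mul1 mulmxBl mul1mx mulmxN opprK -image_edge.
  by rewrite mulmxBr [- _ + _]addrC addrA subrK.
rewrite -edge_third mulDM grad_edge_mul2 mulmxBl mul1mx.
have -> : sin t *: w - cos t *: (rot90 *m w) = vertexE (2 * t) - Rs *m vertexI 0.
  by rewrite image_third -[in RHS]reflected_edge turn_combination opprB.
by rewrite mulmxBr addrCA [_ - _ - _]addrAC subrr sub0r.
Qed.

End Wells.

Section Conjugation.
Context {R : realType} (n : nat) (b rE rI : R).

Lemma outer_mulmx (M : 'M[R]_2) (p q : 'cV[R]_2) :
  outer (M *m p) (M *m q) = M *m outer p q *m M^T.
Proof. by rewrite /outer trmx_mul !mulmxA. Qed.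

Let vertexE_rot s : vertexE rE s = rotmx s *m vertexE rE 0.
Proof. by rewrite /vertexE rotmx_dir add0r. Qed.
Let vertexI_rot s : vertexI b rI s = rotmx s *m vertexI b rI 0.
Proof. by rewrite /vertexI rotmx_dir add0r addrC. Qed.
Let dir_rot s s' : dir (s + s') = rotmx s *m dir s' :> 'cV[R]_2.
Proof. by rewrite -[dir s']scale1r rotmx_dir scale1r addrC. Qed.

Lemma grad_outer_rot s : grad_outer n b rE rI s =
  rotmx s *m grad_outer n b rE rI 0 *m (rotmx s)^T.
Proof.
rewrite /grad_outer vertexE_rot dir_rot sub0r outer_mulmx.
by rewrite -scalemxAr -scalemxAl.
Qed.

Lemma rotmxK s : rotmx s *m (rotmx s)^T = 1%:M :> 'M[R]_2.
Proof. by rewrite trmx_rotmx -rotmxD subrr rotmx0. Qed.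

Lemma grad_edge_rot s : grad_edge n b rE rI s =
  rotmx s *m grad_edge n b rE rI 0 *m (rotmx s)^T.
Proof.
rewrite /grad_edge vertexI_rot dir_rot add0r outer_mulmx mulmxDr mulmxDl mulmx1 rotmxK.
by rewrite -scalemxAr -scalemxAl.
Qed.

(** Plane rotations commute, so turning a triangle conjugates the gradient of the
    deformation. *)
Lemma conj_rotation (s r : R) (X : 'M[R]_2) :
  rotmx r + (1%:M - rotmx r) *m (rotmx s *m X *m (rotmx s)^T) =
  rotmx s *m (rotmx r + (1%:M - rotmx r) *m X) *m (rotmx s)^T.
Proof.
have C : rotmx r *m rotmx s = rotmx s *m rotmx r :> 'M[R]_2 by rewrite -!rotmxD addrC.
rewrite [in RHS]mulmxDr [in RHS]mulmxDl -C -(mulmxA (rotmx r)) rotmxK mulmx1.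
congr (_ + _); rewrite !mulmxA; congr (_ *m _ *m _).
by rewrite mulmxBl mulmxBr mul1mx mulmx1 C.
Qed.

End Conjugation.

(** * The deformation *)
Section Statement.
Context {R : realType} (n : nat) (alpha a rI rE : R).
Hypotheses (n3 : (3 <= n)%N) (alpha01 : 0 < alpha < 1) (a0 : 0 < a)
  (rI0 : 0 < rI) (rIE : rI < rE).
Hypothesis hratio : rI / rE = (cos (pi / n%:R))^-1 *
     (cos (pi / n%:R * (1 - 2 * alpha)) -
      Num.sqrt (sin (2 * pi / n%:R * alpha) * sin (2 * pi / n%:R * (1 - alpha)))).
Hypothesis adef : a = Num.sqrt (sin (2 * pi / n%:R * (1 - alpha)) /
                         sin (2 * pi / n%:R * alpha)).
Local Notation t := (@half_angle R n).
Local Notation ang := (@sector_angle R n).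
Local Notation b := (2 * t * alpha).
Local Notation b' := (2 * t - b).
Local Notation d := (t - b).

Let rE0 : 0 < rE := lt_trans rI0 rIE.
Let t0 : 0 < t := half_angle_gt0 n3.
Let b_gt0 : 0 < b.
Proof. by case/andP: alpha01 => h _; rewrite mulr_gt0// mulr_gt0. Qed.
Let b_lt : b < 2 * t.
Proof. by case/andP: alpha01 => _ h; rewrite gtr_pMr// mulr_gt0. Qed.

Let bE : 2 * pi / n%:R * alpha = b. Proof. by rewrite /half_angle; ring. Qed.
Let b'E : 2 * pi / n%:R * (1 - alpha) = b'. Proof. by rewrite /half_angle; ring. Qed.
Let dE : pi / n%:R * (1 - 2 * alpha) = d. Proof. by rewrite /half_angle; ring. Qed.
Let rhoE : 2 * pi / n%:R * (1 - 2 * alpha) = 2 * d. Proof. by rewrite /half_angle; ring. Qed.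

Let sb : 0 < sin b := sinb_gt0 n3 b_gt0 b_lt.
Let sb' : 0 < sin b' := sinb'_gt0 n3 b_gt0 b_lt.
Let ct : 0 < cos t := cos_half_angle_gt0 n3.

Let sg : R := Num.sqrt (sin b * sin b').
Let sg0 : 0 < sg. Proof. by rewrite sqrtr_gt0 mulr_gt0. Qed.

Lemma aspect_sg : a * sg = sin b'.
Proof.
rewrite adef b'E bE /sg -sqrtrM ?divr_ge0 ?ltW//.
rewrite mulrA divfK ?gt_eqF// -expr2 sqrtr_sqr gtr0_norm//.
Qed.

Lemma radii_outer : sg * rE = rE * cos d - rI * cos t.
Proof.
have cN : cos t != 0 by rewrite gt_eqF.
have rN : rE != 0 by rewrite gt_eqF.
have : rI * cos t = rE * (cos d - sg).
  rewrite -[rI](divfK rN) hratio bE b'E dE -/sg -/(half_angle n).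
  by field.
by move=> ->; ring.
Qed.

(** The formula for the radii makes [r = rI / rE] a root of
    [cos t (1 + r^2) = 2 r cos d]; this is [radii_outer] times [r], simplified by
    that equation. *)
Lemma radii_inner : sg * rI = rE * cos t - rI * cos d.
Proof.
have cN : cos t != 0 by rewrite gt_eqF.
have sg2 : sg ^+ 2 = cos d ^+ 2 - cos t ^+ 2.
  rewrite sqr_sqrtr ?mulr_ge0 ?ltW//.
  rewrite (_ : sin b = sin (t - d)); last by congr sin; ring.
  rewrite (_ : sin b' = sin (t + d)); last by congr sin; ring.
  rewrite (sinB t d) (sinD t d).
  transitivity (sin t ^+ 2 * cos d ^+ 2 - cos t ^+ 2 * sin d ^+ 2); first by ring.
  by rewrite !sin2cos2; ring.
apply: (mulIf cN).
have E : rI * cos t = rE * cos d - sg * rE by rewrite radii_outer; ring.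
transitivity (sg * (rI * cos t)); first by ring.
transitivity (rE * cos t ^+ 2 - (rI * cos t) * cos d); last by ring.
rewrite E; transitivity (sg * rE * cos d - rE * sg ^+ 2); first by ring.
by rewrite sg2; ring.
Qed.

Let outside : rI * cos t < rE * cos d.
Proof. by rewrite -subr_gt0 -radii_outer mulr_gt0. Qed.
Let inside : rI * cos d < rE * cos t.
Proof. by rewrite -subr_gt0 -radii_inner mulr_gt0. Qed.

Lemma EptE (i : nat) : Ept n rE i = vertexE rE (ang (i%:Z - 1)).
Proof.
have -> : ang (i%:Z - 1) = 2 * pi / n%:R * (i%:R - 1).
  by rewrite /sector_angle /half_angle intrB -pmulrn; ring.
by apply: cV2P; rewrite /Ept !mxE/= ?mulr1 ?mulr0 ?addr0 ?add0r.
Qed.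

Lemma IptE (i : nat) : Ipt n alpha rI i = vertexI b rI (ang (i%:Z - 1)).
Proof.
have E : ang (i%:Z - 1) + b = 2 * pi / n%:R * (i%:R - 1) + alpha * (2 * pi / n%:R).
  by rewrite /sector_angle /half_angle intrB -pmulrn; ring.
by rewrite /vertexI E; apply: cV2P; rewrite /Ipt !mxE/= ?mulr1 ?mulr0 ?addr0 ?add0r.
Qed.

(** The [n] vertices of the statement are all the vertices, by periodicity. *)
Lemma polygon_image (r s : R) (p : nat -> 'cV[R]_2) :
  (forall i, p i = r *: dir (ang (i%:Z - 1) + s)) ->
  convex_hull [set p i | i in [set i | (1 <= i <= n)%N]] = polygon n r s.
Proof.
move=> pE; congr convex_hull; apply/seteqP; split => [_ [i _ <-]|_ [k _ <-]].
  by exists (i%:Z - 1).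
have [j [q ->]] := ang_modn n3 k.
exists j.+1; first by rewrite /= ltn_ord.
rewrite pE [in RHS]angD [in RHS]angMn// [in RHS]addrAC dir_period.
by rewrite (_ : j.+1%:Z - 1 = j)// -addn1 PoszD addrK.
Qed.

Lemma OmegaE_polygon : OmegaE n rE = polygon n rE 0.
Proof. by apply: polygon_image => i; rewrite EptE /vertexE addr0. Qed.

Lemma OmegaI_polygon : OmegaI n alpha rI = polygon n rI b.
Proof. by apply: polygon_image => i; rewrite IptE. Qed.

Local Notation v := (vertexI b rI 0 - vertexE rE 0).
Local Notation Rs := (rotmx (2 * d)).
Local Notation V := (interpolant n b rE rI).

Definition deformation (x : 'cV[R]_2) : 'cV[R]_2 := Rs *m x + (1%:M - Rs) *m V x.

Lemma deformation_affine_near x A : affine_near V x A ->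
  affine_near deformation x (Rs + (1%:M - Rs) *m A).
Proof.
move=> [c VA]; exists ((1%:M - Rs) *m c).
apply: (@filterS _ _ (nbhs_filter x) _ _ _ VA) => y Vy.
by rewrite /deformation Vy mulmxDr addrA mulmxA -mulmxDl.
Qed.

Lemma deformation_affine_on (T : set 'cV[R]_2) A c :
  (forall x, T x -> V x = A *m x + c) -> affine_on T deformation.
Proof.
move=> VA; exists (Rs + (1%:M - Rs) *m A), ((1%:M - Rs) *m c) => x Tx.
by rewrite /deformation VA// mulmxDr addrA mulmxA -mulmxDl.
Qed.

Lemma deformation_lipschitz :
  exists L : R, forall i, lipschitz_with L (fun x => deformation x i 0).
Proof.
have l (i : 'I_2) : lipschitz_fun (fun x => deformation x i 0).
  have E : (fun x => deformation x i 0) = fun x =>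
      (x 0 0 * Rs i 0 + x 1 0 * Rs i 1) +
      (V x 0 0 * (1%:M - Rs) i 0 + V x 1 0 * (1%:M - Rs) i 1).
    apply/funext => x; rewrite /deformation [LHS]mxE; congr (_ + _).
      by rewrite mulmx2; congr (_ + _); rewrite mulrC.
    by rewrite mulmx2; congr (_ + _); rewrite mulrC.
  rewrite E; apply: lipschitz_funD; apply: lipschitz_funD; apply: lipschitz_funM;
    try exact: lipschitz_interpolant; apply: affine_fun_lipschitz.
    by exists 1, 0, 0 => x; ring.
  by exists 0, 1, 0 => x; ring.
have [L0 l0] := l 0; have [L1 l1] := l 1.
exists (Num.max L0 L1) => i.
have [->|->] : i = 0 \/ i = 1.
  by case: i => -[|[|//]] ?; [left|right]; exact: val_inj.
- by apply: lipschitz_withW l0; rewrite le_max lexx.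
- by apply: lipschitz_withW l1; rewrite le_max lexx orbT.
Qed.

Lemma deformation_triangles (i : nat) : (1 <= i)%N ->
  affine_on (Ttri n alpha rE rI i) deformation.
Proof.
move=> i1; rewrite /Ttri; case: ifPn => odd_i.
  have [k kE] : exists k, i = k.*2.+1.
    by exists i./2; rewrite -[LHS]odd_double_half odd_i.
  rewrite kE /= !doubleK /open_triangle EptE !IptE.
  rewrite (_ : k.+1%:Z - 1 = k%:Z); last by rewrite -addn1 PoszD addrK.
  rewrite angD (_ : ang (-1) = - (2 * t)); last by rewrite /sector_angle mulrN1.
  apply: deformation_affine_on => x /interior_subset hx.
  rewrite (interpolant_outer_triangle n3 b_gt0 b_lt rI0 rE0 outside inside hx).
  exact: (grad_outer_affine n3 rI0 outside).
have [k kE] : exists k, i = k.+1.*2.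
  exists i./2.-1; rewrite -[LHS]odd_double_half (negbTE odd_i) add0n prednK//.
  by rewrite half_gt0; case: i i1 odd_i => [|[|]].
rewrite kE !doubleK /open_triangle !EptE !IptE.
rewrite (_ : k.+1%:Z - 1 = k%:Z); last by rewrite -addn1 PoszD addrK.
rewrite (_ : (1 + k.+1)%:Z - 1 = k%:Z + 1); last first.
  by rewrite PoszD addrAC subrr add0r -addn1 PoszD.
rewrite angD ang1.
apply: deformation_affine_on => x /interior_subset hx.
rewrite (interpolant_edge_triangle n3 b_gt0 b_lt rI0 rE0 outside inside hx).
exact: (grad_edge_affine n3 rE0 inside).
Qed.

Local Notation e := ((enorm v)^-1 *: v).
Local Notation e' := (rot90 *m e).
Local Notation U := (a *: outer e e + a^-1 *: outer e' e' +
  ((a^-1 - a) * (sin t / cos t)) *: outer e e').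

Lemma e11E : e11 n alpha rE rI = e.
Proof. by rewrite /e11 EptE IptE subrr /sector_angle mulr0. Qed.

Lemma e11pE : e11p n alpha rE rI = e'.
Proof. by rewrite /e11p e11E. Qed.

Lemma UmxE : Umx n alpha rE rI a = U.
Proof.
rewrite /Umx e11E e11pE; congr (_ + _ *: _); congr (_ * _).
rewrite /tan invf_div.
have nN : (n%:R : R) != 0 by rewrite gt_eqF// ltr0n; case: n n3.
rewrite (_ : (n%:R - 2) * pi / (2 * n%:R) = pi / 2 - t); last by rewrite /half_angle; field.
by rewrite cosB sinB cos_pihalf sin_pihalf !mul0r !mul1r add0r subr0.
Qed.

Lemma rotation_R1 (k : int) : R1set n (rotmx (ang k)).
Proof.
have [j [q ->]] := ang_modn n3 k.
exists j; first exact: ltn_ord.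
rewrite angD angMn// rotmx_period; congr rotmx.
by rewrite /sector_angle /half_angle -pmulrn; ring.
Qed.

Lemma wellsP (P Q : 'M[R]_2) : Pset n alpha rE rI P -> SO2 Q ->
  wells n alpha rE rI a (Q *m P *m U *m P^T).
Proof. by move=> hP hQ; exists P => //; exists Q; rewrite ?UmxE. Qed.

(** At the index [k] the gradient is conjugated by the rotation of angle [ang k].
    This rotation commutes with the similarity, and moving it across the
    reflection replaces it by its inverse. *)
Lemma gradient_wells (k : int) A :
  A = grad_outer n b rE rI (ang k) \/ A = grad_edge n b rE rI (ang k) ->
  wells n alpha rE rI a (Rs + (1%:M - Rs) *m A).
Proof.
have v0 := @edge_neq0 _ n b rE rI n3 b_gt0 b_lt rI0.
have Q2 := similarity_to_SO2 v0 (norm_w n b rE rI).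
case=> ->.
  rewrite grad_outer_rot conj_rotation.
  rewrite (outer_gradient_well n3 b_gt0 b_lt rI0 outside sg0 a0
    radii_outer radii_inner aspect_sg).
  rewrite !mulmxA -similarity_to_rotmx.
  by apply: wellsP => //; left; exact: rotation_R1.
rewrite grad_edge_rot conj_rotation.
rewrite (edge_gradient_well n3 b_gt0 b_lt rI0 rE0 inside sg0 a0
  radii_outer radii_inner aspect_sg).
rewrite !mulmxA -similarity_to_rotmx -(mulmxA _ (rotmx _) (reflection _)) rotmx_reflection.
rewrite -!mulmxA -trmx_mul rotmx_reflection !mulmxA.
rewrite -(mulmxA (similarity_to _ _) (reflection _) (rotmx _)).
apply: wellsP => //; right; exists (rotmx (- ang k)).
  have -> : - ang k = ang (- k) by rewrite /sector_angle mulrNz mulrN.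
  exact: rotation_R1.
by rewrite e11E e11pE.
Qed.

Lemma deformation_W1oo : W1oo_loc deformation (weak_gradient deformation).
Proof.
have [L lip] := deformation_lipschitz; apply: (lipschitz_W1oo_loc lip).
apply: (@filterS _ _ (ae_filter_ringOfSetsType _) _ _ _ (ae_generic n b rE rI)) => p gp.
have [A VA _] := generic_affine_near n3 b_gt0 b_lt rI0 rE0 outside inside gp.
by exists (Rs + (1%:M - Rs) *m A); exact: deformation_affine_near.
Qed.

Lemma deformation_outside x : ~ OmegaE n rE x -> deformation x = x.
Proof.
rewrite OmegaE_polygon => nx; rewrite /deformation.
rewrite (interpolant_outside n3 b_gt0 b_lt rI0 rE0 outside inside nx).
by rewrite mulmxBl mul1mx addrC subrK.
Qed.

Lemma deformation_inside x : OmegaI n alpha rI x ->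
  deformation x = rotmx (2 * pi / n%:R * (1 - 2 * alpha)) *m x.
Proof.
rewrite OmegaI_polygon => px; rewrite /deformation rhoE.
rewrite (interpolant_inside n3 b_gt0 b_lt rI0 rE0 outside inside px).
by rewrite mulmx0 addr0.
Qed.

Lemma deformation_wells : {ae leb2 R, forall p,
  (OmegaE n rE `\` OmegaI n alpha rI) (pt p) ->
  wells n alpha rE rI a (weak_gradient deformation (pt p))}.
Proof.
apply: (@filterS _ _ (ae_filter_ringOfSetsType _) _ _ _ (ae_generic n b rE rI)) => p gp.
have [A VA wellA] := generic_affine_near n3 b_gt0 b_lt rI0 rE0 outside inside gp.
rewrite OmegaE_polygon OmegaI_polygon => -[pE pI].
have [k Ak] := wellA pE pI.
rewrite (weak_gradient_affine (deformation_affine_near VA)).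
exact: gradient_wells Ak.
Qed.

End Statement.

Theorem proposition2p5 (R : realType) (n : nat) (alpha a rI rE : R)
  (hn : (3 <= n)%N) (halpha : 0 < alpha < 1) (ha : 0 < a)
  (hrI : 0 < rI) (hrE : rI < rE)
  (hratio : rI / rE = (cos (pi / n%:R))^-1 *
     (cos (pi / n%:R * (1 - 2 * alpha)) -
      Num.sqrt (sin (2 * pi / n%:R * alpha) * sin (2 * pi / n%:R * (1 - alpha)))))
  (hadef : a = Num.sqrt (sin (2 * pi / n%:R * (1 - alpha)) /
                         sin (2 * pi / n%:R * alpha))) :
  exists (u : 'cV[R]_2 -> 'cV[R]_2) (Du : 'cV[R]_2 -> 'M[R]_2),
    W1oo_loc u Du /\
    (forall i : nat, (1 <= i <= 2 * n)%N ->
       affine_on (Ttri n alpha rE rI i) u) /\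
    (forall x, ~ OmegaE n rE x -> u x = x) /\
    {ae leb2 R, forall p, (OmegaE n rE `\` OmegaI n alpha rI) (pt p) ->
       wells n alpha rE rI a (Du (pt p))} /\
    (forall x, OmegaI n alpha rI x ->
       u x = rotmx (2 * pi / n%:R * (1 - 2 * alpha)) *m x).
Proof.
exists (deformation n alpha rI rE), (weak_gradient (deformation n alpha rI rE)).
split; [|split; [|split; [|split]]].
- exact: deformation_W1oo.
- by move=> i /andP[i1 _]; exact: deformation_triangles.
- by move=> x; exact: deformation_outside.
- exact: deformation_wells.
- by move=> x; exact: deformation_inside.
Qed.
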